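(* Let $0<b<1$ and $0<\alpha\le 1$. Let $\{Z(t),t\ge0\}$ be an $I_0$-valued Lévy process. Consider the $I_0$-valued first-order autoregressive scheme $$X_n=b\otimes X_{n-1}+\varepsilon_n,\qquad n=1,2,\dots,$$ where $X_0\overset{d}{=}Z(1)$, the innovations $\{\varepsilon_n\}$ are i.i.d. with $\varepsilon_n\overset{d}{=}b\otimes Z(b^{-\alpha}-1)$ for all $n$, and $\varepsilon_n$ is independent of $X_{n-1}$ and of the thinning at step $n$. Then: if $\{Z(t)\}$ is $(b^\alpha,\tfrac1\alpha)$-semi-selfsimilar, the sequence $\{X_n\}$ is stationary with $I_0$-valued semi-stable$(b^\alpha,b)$ marginals. Conversely, if $\{X_n\}$ is stationary, then its marginals are $I_0$-valued semi-stable$(b^\alpha,b)$ and $\{Z(t)\}$ is $(b^\alpha,\tfrac1\alpha)$-semi-selfsimilar.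
   Context: $I_0=\{0,1,2,\dots\}$. A Lévy process is a process with stationary and independent increments and $Z(0)=0$; if $P(s)$ is the probability generating function (PGF) of $Z(1)$ then that of $Z(t)$ is $P(s)^t$. Binomial thinning: for $0<c<1$ and an $I_0$-valued random variable $X$, $c\otimes X=\sum_{i=1}^{X}Y_i$ with $\{Y_i\}$ i.i.d. Bernoulli, independent of $X$, $P\{Y_i=1\}=c$; its PGF is $P(1-c+cs)$ if $X$ has PGF $P(s)$. An $I_0$-valued process $\{Z(t),t\ge0\}$ is $(a,H)$-semi-selfsimilar, with $0<a<1$, $H>0$, if $\{Z(at)\}\overset{d}{=}\{a^H\otimes Z(t)\}$. An $I_0$-valued random variable with PGF $P(s)$ is discrete semi-stable$(a,b)$ if $P(s)\neq0$ and $\{P(s)\}^a=P(1-b+bs)$ for all $0\le s\le1$, with $0<b<1$ and $b=a^{1/\alpha}$, $\alpha\in(0,1]$. All notions are in the strict sense. *)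

(* Defs.v *)
From HB Require Import structures.
From mathcomp Require Import all_boot all_order all_algebra.
From mathcomp Require Import all_classical all_reals all_analysis.
Set Implicit Arguments.
Unset Strict Implicit.
Unset Printing Implicit Defensive.
Import Order.TTheory GRing.Theory Num.Theory.
Import numFieldNormedType.Exports.
Local Open Scope classical_set_scope.
Local Open Scope ring_scope.

Section Defs.
Context {R : realType}.

Definition nat_rv {d} {T : measurableType d} (X : T -> nat) : Prop :=
  forall k : nat, measurable (X @^-1` [set k]).

(* Mutual independence of a family of discrete (countably-valued) random
   variables: for every finite injective subfamily and every choice of
   values, the joint point probability factorizes. *)
Definition mutually_indep {d} {T : measurableType d} (P : probability T R)
  {I V : Type} (F : I -> T -> V) : Prop :=
  forall (n : nat) (f : 'I_n -> I), injective f ->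
  forall vs : 'I_n -> V,
    P [set w | forall j, F (f j) w = vs j] =
    (\prod_(j < n) P [set w | F (f j) w = vs j])%E.

Definition fdd {d} {T : measurableType d} (P : probability T R) {I : Type}
  (Z : I -> T -> nat) (ts : seq I) (ks : seq nat) : \bar R :=
  P [set w | map (fun t => Z t w) ts = ks].

(* Probability that binomial thinning c (x) with a single i.i.d.
   Bernoulli(c) sequence Y_1, Y_2, ... maps the values xs to ks, i.e.
   P{ sum_{i<=x_j} Y_i = k_j for all j }.  Only the first N = max xs
   Bernoulli variables matter, so this is a finite sum. *)
Definition thin_prob (c : R) (xs ks : seq nat) : R :=
  let N := (\max_(x <- xs) x)%N in
  \sum_(y : {ffun 'I_N -> bool})
     (\prod_(i < N) (if y i then c else 1 - c)) *
     (all2 (fun x k => (\sum_(i < N | (i < x)%N) nat_of_bool (y i))%N == k)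
        xs ks)%:R.

(* Finite-dimensional distributions of the thinned process
   {c (x) Z(t)} = { sum_{i=1}^{Z(t)} Y_i }, Y i.i.d. Bernoulli(c)
   independent of Z.  For a single time this is the law of c (x) Z(t). *)
Definition thin_fdd {d} {T : measurableType d} (P : probability T R)
  {I : Type} (c : R) (Z : I -> T -> nat) (ts : seq I) (ks : seq nat) : \bar R :=
  (\int[P]_w (thin_prob c (map (fun t => Z t w) ts) ks)%:E)%E.

Definition pgf {d} {T : measurableType d} (P : probability T R)
  (X : T -> nat) (s : R) : R :=
  fine (\int[P]_w (s ^+ X w)%:E)%E.

Definition levy_process {d} {T : measurableType d} (P : probability T R)
  (Z : R -> T -> nat) : Prop :=
  [/\ (forall t, 0 <= t -> nat_rv (Z t)),
      P [set w | Z 0 w = 0%N] = 1%E,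
      (forall s h, 0 <= s -> 0 <= h -> forall v : int,
         P [set w | (Z (s + h) w)%:Z - (Z s w)%:Z = v] =
         P [set w | (Z h w)%:Z = v]) &
      (forall (m : nat) (ts : 'I_m.+1 -> R),
         0 <= ts ord0 -> (forall j : 'I_m, ts (widen_ord (leqnSn m) j) < ts (lift ord0 j)) ->
         mutually_indep P (fun j : 'I_m => fun w =>
            (Z (ts (lift ord0 j)) w)%:Z - (Z (ts (widen_ord (leqnSn m) j)) w)%:Z))].

Definition semi_selfsimilar {d} {T : measurableType d} (P : probability T R)
  (a H : R) (Z : R -> T -> nat) : Prop :=
  [/\ 0 < a < 1, 0 < H &
      forall (ts : seq R) (ks : seq nat), all (fun t => 0 <= t) ts ->
        fdd P (fun t => Z (a * t)) ts ks = thin_fdd P (a `^ H) Z ts ks].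

Definition disc_semistable {d} {T : measurableType d} (P : probability T R)
  (a b : R) (X : T -> nat) : Prop :=
  [/\ 0 < a < 1, 0 < b < 1,
      (exists al : R, 0 < al <= 1 /\ b = a `^ al^-1) &
      forall s, 0 <= s <= 1 ->
        pgf P X s != 0 /\ pgf P X s `^ a = pgf P X (1 - b + b * s)].

Definition stationary_seq {d} {T : measurableType d} (P : probability T R)
  (X : nat -> T -> nat) : Prop :=
  forall (m : nat) (ns : seq nat) (ks : seq nat),
    fdd P (fun n => X (n + m)%N) ns ks = fdd P X ns ks.

End Defs.

(* Index set of the primitive random ingredients of the INAR(1) scheme:
   X_0, the innovations eps_n (n >= 1) and the thinning Bernoulli
   variables Y_{n,i} (n >= 1) used at step n. *)
Inductive ar_idx := AX0 | AEps of nat | AY of nat & nat.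

Definition ar_family {T : Type} (X0 : T -> nat) (eps : nat -> T -> nat)
  (Y : nat -> nat -> T -> nat) (i : ar_idx) : T -> nat :=
  match i with
  | AX0 => X0
  | AEps n => eps n.+1
  | AY n j => Y n.+1 j
  end.

Definition inar1 {R : realType} {d} {T : measurableType d} (P : probability T R)
  (b : R) (X eps : nat -> T -> nat) (Y : nat -> nat -> T -> nat) : Prop :=
  [/\ [/\ nat_rv (X 0%N),
      (forall n, (1 <= n)%N -> nat_rv (eps n)) &
      (forall n i, (1 <= n)%N -> nat_rv (Y n i))],
      (forall n i, (1 <= n)%N ->
         P [set w | Y n i w = 1%N] = b%:E /\ P [set w | Y n i w = 0%N] = (1 - b)%:E),
      mutually_indep P (ar_family (X 0%N) eps Y) &
      (forall n w, (1 <= n)%N ->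
         X n w = ((\sum_(i < X n.-1 w) Y n i w) + eps n w)%N)].

(* Main.v *)
(** Write [P_t] for the generating function of [Z t], [a = b ^ alpha] and
    [u s = 1 - b + b s].  A monotonicity argument turns the multiplicativity of
    [t |-> P_t s] into [P_t s = P_1 s ^ t], so [X_1] has generating function
    [P_1 (u s) * P_1 (u s) ^ (1 / a - 1) = P_1 (u s) ^ (1 / a)].  Hence [X_1] and
    [X_0] are equidistributed iff [P_1 s ^ a = P_1 (u s)], i.e. iff
    [P_(a t) s = P_t (u s)] for all [t]: the one-dimensional form of
    semi-selfsimilarity.  This lifts to all finite-dimensional laws because [X]
    is a homogeneous Markov chain and because both [Z] and its thinning have
    stationary independent increments.  The thinning probabilities are realized
    by the Bernoulli variables [Y 1] of the autoregressive scheme. *)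
Require Import Defs.
From HB Require Import structures.
From mathcomp Require Import all_boot all_order all_algebra.
From mathcomp Require Import all_classical all_reals all_analysis.
From mathcomp Require Import measurable_realfun.
From mathcomp Require Import ring lra.
Set Implicit Arguments.
Unset Strict Implicit.
Unset Printing Implicit Defensive.
Import Order.TTheory GRing.Theory Num.Theory.
Import numFieldNormedType.Exports.
Local Open Scope classical_set_scope.
Local Open Scope ring_scope.

(** [levy_process] gives independence along strictly increasing times, while semi-selfsimilarity
    quantifies over arbitrary lists of times. The link is the product form [chain]: the laws of [Z],
    of the Bernoulli partial sums at increasing sizes, and of the paths of [X] are all products of
    transition weights. Thinning [Z] then amounts to composing two chains, the states of the first
    serving as the times of the second, so that only the weights of a single step have to be
    compared. [Z] lives on a space of its own and no product space is built: a thinned law is a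
    mixture, over the paths of [Z], of laws of Bernoulli sums taken on the space of [X]. All laws
    are countable and are handled as [esum]s in the extended reals, where nonnegative sums can be
    exchanged without summability conditions. Semi-stability and the logarithm of [P_1] require
    [P_1 0 > 0]; this comes from the infinite divisibility of [Z 1]. *)

(** * Sums of nonnegative extended reals over arbitrary index sets *)

Section Esum.
Context {R : realType}.
Local Open Scope ereal_scope.

(** One inequality holds on finite subsums for every factor; the other is the same inequality
    applied to [r^-1] and [r * f]. The factors [0] and [+oo] have no usable inverse and are treated
    apart: for [+oo], one positive term already makes both sides infinite. *)
Lemma esumZ (I : choiceType) (A : set I) (r : \bar R) (f : I -> \bar R) :
  0 <= r -> (forall i, 0 <= f i) ->
  \esum_(i in A) (r * f i) = r * \esum_(i in A) f i.
Proof.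
move=> r0 f0; have le_esumZ (q : \bar R) (g : I -> \bar R) : 0 <= q ->
    (forall i, 0 <= g i) -> \esum_(i in A) (q * g i) <= q * \esum_(i in A) g i.
  move=> q0 g0; apply: ge_ereal_sup => _ [F FA <-].
  rewrite -ge0_mule_fsumr//; apply: lee_wpmul2l => //.
  by apply: ereal_sup_ubound; exists F.
have [r00|r_neq0] := eqVneq r 0.
  by rewrite r00 mul0e; apply: esum1 => i _; rewrite mul0e.
have rgt0 : 0 < r by rewrite lt0e r_neq0.
have [f_eq0|] := pselect (forall i, A i -> f i = 0).
  by rewrite !esum1 ?mule0// => i Ai; rewrite f_eq0// mule0.
move=> /existsNP[i /not_implyP[Ai /eqP fi_neq0]].
have fi_gt0 : 0 < f i by rewrite lt0e fi_neq0 f0.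
apply/eqP; rewrite eq_le le_esumZ//=.
case: r r0 r_neq0 rgt0 => [r| |]// r0 r_neq0 rgt0; last first.
  rewrite gt0_mulye; last first.
    apply: (lt_le_trans fi_gt0); apply: ereal_sup_ubound; exists [set i].
      by split => // _ ->.
    by rewrite fsbig_set1.
  apply: ereal_sup_ubound; exists [set i]; first by split => // _ ->.
  by rewrite fsbig_set1 gt0_mulye.
rewrite lte_fin in rgt0.
have {1}-> : f = (fun i => (r^-1)%:E * (r%:E * f i)).
  by apply/funext => j; rewrite muleA -EFinM mulVf ?mul1e// gt_eqF.
have rr x : x = r%:E * ((r^-1)%:E * x) :> \bar R.
  by rewrite muleA -EFinM divff ?mul1e// gt_eqF.
rewrite [leRHS]rr; apply: lee_wpmul2l; first exact: ltW.
apply: le_esumZ => [|j]; first by rewrite lee_fin invr_ge0 ltW.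
exact: mule_ge0.
Qed.

Lemma esum_exchange (I J : choiceType) (A : set I) (B : set J)
    (f : I -> J -> \bar R) : (forall i j, 0 <= f i j) ->
  \esum_(i in A) \esum_(j in B) f i j = \esum_(j in B) \esum_(i in A) f i j.
Proof.
move=> f0; rewrite !esum_esum//.
rewrite (@reindex_esum _ _ _ (A `*`` (fun=> B)) (B `*`` (fun=> A))
  (fun x => (x.2, x.1)))//; split.
- by move=> [i j] /= [].
- by move=> [i j] [i' j'] _ _ /= [-> ->].
- by move=> [j i] /= [Bj Ai]; exists (i, j).
Qed.

Lemma esum_delta (I : choiceType) (i0 : I) (f : I -> \bar R) :
  0 <= f i0 -> (forall i, i != i0 -> f i = 0) ->
  \esum_(i in [set: I]) f i = f i0.
Proof.
move=> f0 fN; rewrite -[RHS](esum_set1 f0) [RHS]esum_mkcond.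
apply: eq_esum => i _; case: ifPn => // i_i0.
by apply: fN; apply: contra i_i0 => /eqP ->; rewrite inE.
Qed.

(** Peeling off the head of a list is the inductive step for sums over all intermediate paths in
    [chain_comp]. *)
Lemma esum_seq (I : choiceType) (f : seq I -> \bar R) :
  (forall s, 0 <= f s) -> f [::] = 0 ->
  \esum_(s in [set: seq I]) f s =
  \esum_(x in [set: I]) \esum_(s in [set: seq I]) f (x :: s).
Proof.
move=> f0 fnil; rewrite esum_esum//= (esumID [set [::]])//.
rewrite setTI esum_set1// fnil add0e setTI.
rewrite (@reindex_esum _ _ _ ([set: I] `*`` (fun=> [set: seq I])) _
  (fun x => x.1 :: x.2))//; split.
- by move=> [x s] _ /=.
- by move=> [x s] [y t] _ _ /= [-> ->].
- by move=> [/(_ erefl)//|x s _]; exists (x, s).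
Qed.

Lemma esum_shift (m : nat) (f : nat -> \bar R) : (forall n, 0 <= f n) ->
  \esum_(n in [set: nat]) (if (m <= n)%N then f (n - m)%N else 0) =
  \esum_(n in [set: nat]) f n.
Proof.
move=> f0.
transitivity (\esum_(n in [set n | (m <= n)%N]) f (n - m)%N).
  by rewrite [RHS]esum_mkcond; apply: eq_esum => n _; rewrite mem_setE.
rewrite (@reindex_esum _ _ _ [set: nat] _ (addn m)).
  by apply: eq_esum => n _; rewrite addKn.
split=> [n _|x y _ _|n /= mn]; first by rewrite /= leq_addr.
  exact: addnI.
by exists (n - m)%N => //; rewrite subnKC.
Qed.

End Esum.

(** * Laws and expectations of countably valued random variables *)

Section DiscreteLaw.
Context {R : realType} {d : measure_display} {T : measurableType d}.
Local Open Scope ereal_scope.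

(** For [C = nat] this is convertible to [nat_rv]; the general codomain accommodates pairs and lists
    of values. *)
Definition discrete_rv {C : Type} (U : T -> C) :=
  forall c, measurable [set w | U w = c].

Lemma discrete_rv_event {C : countType} (U : T -> C) (A : set C) :
  discrete_rv U -> measurable [set w | A (U w)].
Proof.
move=> mU; have -> : [set w | A (U w)] =
    \bigcup_(c in [set: C]) [set w | U w = c /\ A c].
  by apply/seteqP; split=> [w /= Aw|w [c _ [<-]]]//; exists (U w).
apply: countable_bigcupT_measurable => // c; have [Ac|Ac] := pselect (A c).
  by rewrite [X in measurable X](_ : _ = [set w | U w = c])//; apply/seteqP; split=> w /= => [[]|].
by rewrite [X in measurable X](_ : _ = set0)//; apply/seteqP; split=> w /= => [[]|].
Qed.

Lemma discrete_rv_comp {C : countType} {D : Type} (U : T -> C) (g : C -> D) :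
  discrete_rv U -> discrete_rv (fun w => g (U w)).
Proof. by move=> mU e; exact: (@discrete_rv_event _ U [set c | g c = e]). Qed.

Lemma discrete_rv_pair {C D : Type} (U : T -> C) (V : T -> D) :
  discrete_rv U -> discrete_rv V -> discrete_rv (fun w => (U w, V w)).
Proof.
move=> mU mV [a b]; rewrite [X in measurable X](_ : _ =
  [set w | U w = a] `&` [set w | V w = b]); first exact: measurableI.
by apply/seteqP; split=> w /= [-> ->].
Qed.

Lemma discrete_rv_map {I : eqType} {C : Type} (F : I -> T -> C) (s : seq I) :
  (forall i, i \in s -> discrete_rv (F i)) ->
  discrete_rv (fun w => [seq F i w | i <- s]).
Proof.
elim: s => [_ [|c v]|i s IH sF [|c v]] /=.
- by rewrite [X in measurable X](_ : _ = setT)//; apply/seteqP; split.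
- by rewrite [X in measurable X](_ : _ = set0)//; apply/seteqP; split.
- by rewrite [X in measurable X](_ : _ = set0)//; apply/seteqP; split.
have mi : discrete_rv (F i) by apply: sF; rewrite mem_head.
have ms : discrete_rv (fun w => [seq F i w | i <- s]).
  by apply: IH => j sj; apply: sF; rewrite in_cons sj orbT.
rewrite [X in measurable X](_ : _ =
  [set w | F i w = c] `&` [set w | [seq F i w | i <- s] = v]).
  exact: measurableI.
by apply/seteqP; split=> w /= [-> ->].
Qed.

Variable P : probability T R.

(** Coding the values by [pickle] gives a partition indexed by [nat], to which countable additivity
    applies; numbers that code no value contribute the empty event. *)
Lemma prob_total {C : countType} (U : T -> C) (E : set T) :
  discrete_rv U -> measurable E ->
  P E = \esum_(c in [set: C]) P (E `&` [set w | U w = c]).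
Proof.
move=> mU mE.
pose F n := E `&` [set w | pickle (U w) = n].
have mF n : measurable (F n).
  by apply: measurableI => //; exact: (@discrete_rv_comp _ _ U pickle).
have tF : trivIset setT F.
  by move=> i j _ _ [w [[_ /= <-] [_ /= <-]]].
have EF : E = \bigcup_n F n.
  by apply/seteqP; split=> [w Ew|w [n _ []//]]; exists (pickle (U w)).
rewrite {1}EF measure_semi_bigcup -?EF// nneseries_esumT//.
rewrite (esumID [set pickle c | c in [set: C]])// addeC !setTI esum1 ?add0e.
  rewrite esum_image; last by move=> x y _ _ /(pcan_inj pickleK).
  apply: eq_esum => c _; congr (P _); apply/seteqP; split=> w [Ew /=].
    by move=> /(pcan_inj pickleK).
  by move=> <-.
move=> n /= nC; rewrite [F n](_ : _ = set0)//.
by apply/seteqP; split=> // w [_ /= wn]; apply: nC; exists (U w).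
Qed.

Lemma prob_event {C : countType} (U : T -> C) (A : set C) : discrete_rv U ->
  P [set w | A (U w)] = \esum_(c in A) P [set w | U w = c].
Proof.
move=> mU; rewrite [RHS]esum_mkcond.
rewrite (prob_total mU); last exact: discrete_rv_event.
apply: eq_esum => c _; have [Ac|Ac] := pselect (A c).
  rewrite mem_set//; congr (P _); apply/seteqP; split=> w /=; first by case.
  by move=> Uw; rewrite Uw.
rewrite memNset// [X in P X](_ : _ = set0)//.
by apply/seteqP; split=> w //= [+ Uw]; rewrite Uw.
Qed.

Lemma discrete_rv_measurable_fun {C : countType} (U : T -> C) (f : C -> R) :
  discrete_rv U -> measurable_fun setT (fun w => (f (U w))%:E).
Proof. by move=> mU _ Y mY; rewrite setTI; exact: (@discrete_rv_event _ U [set c | Y (f c)%:E]). Qed.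

Lemma expectation_esum {C : countType} (U : T -> C) (f : C -> R) :
  discrete_rv U -> (forall c, 0 <= f c)%R ->
  \int[P]_w (f (U w))%:E =
  \esum_(c in [set: C]) ((f c)%:E * P [set w | U w = c]).
Proof.
move=> mU f0.
pose F n := [set w | pickle (U w) = n].
have mF n : measurable (F n) by exact: (@discrete_rv_comp _ _ U pickle).
have tF : trivIset setT F by move=> i j _ _ [w [/= <- /= <-]].
have EF : [set: T] = \bigcup_n F n.
  by apply/seteqP; split=> // w _; exists (pickle (U w)).
rewrite EF ge0_integral_bigcup//; first last.
- by move=> w _; rewrite lee_fin.
- by rewrite -EF; exact: discrete_rv_measurable_fun.
rewrite nneseries_esumT => [|n]; last by apply: integral_ge0 => w _; rewrite lee_fin.
rewrite (esumID [set pickle c | c in [set: C]])//; last first.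
  by move=> n _; apply: integral_ge0 => w _; rewrite lee_fin.
rewrite addeC !setTI esum1 ?add0e.
  rewrite esum_image; last by move=> x y _ _ /(pcan_inj pickleK).
  apply: eq_esum => c _; have -> : F (pickle c) = [set w | U w = c].
    by apply/seteqP; split=> w; rewrite /F /=; [move/(pcan_inj pickleK)|move->].
  rewrite -integral_cst//; apply: eq_integral => w.
  by rewrite inE /= => ->.
move=> n /= nC; rewrite [F n](_ : _ = set0) ?integral_set0//.
by apply/seteqP; split=> // w wn; apply: nC; exists (U w).
Qed.

End DiscreteLaw.

(** * Independence of disjoint finite blocks of discrete variables *)

Section Independence.
Context {R : realType} {d : measure_display} {T : measurableType d}.
Variable P : probability T R.
Local Open Scope ereal_scope.

Lemma indep_event {C D : countType} (U : T -> C) (V : T -> D) A B :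
  discrete_rv U -> discrete_rv V ->
  (forall a b, P [set w | U w = a /\ V w = b] =
     P [set w | U w = a] * P [set w | V w = b]) ->
  P [set w | A (U w) /\ B (V w)] = P [set w | A (U w)] * P [set w | B (V w)].
Proof.
move=> mU mV UV; have mUV := discrete_rv_pair mU mV.
rewrite (prob_event P (A `*` B) mUV) !prob_event//.
rewrite muleC -esumZ ?esum_ge0//.
under [RHS]eq_esum => a Aa do rewrite muleC -esumZ//.
rewrite esum_esum => [|a b _ _]; last exact: mule_ge0.
apply: eq_esum => -[a b] _ /=; rewrite -UV; congr (P _).
by apply/seteqP; split=> w /= [-> ->].
Qed.

Context {I : eqType} {V : countType} (F : I -> T -> V).
Hypothesis indepF : mutually_indep P F.
Hypothesis mF : forall i, discrete_rv (F i).

Lemma indep_seq (s : seq I) (v : seq V) : uniq s -> size s = size v ->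
  P [set w | [seq F i w | i <- s] = v] =
  \prod_(p <- zip s v) P [set w | F p.1 w = p.2].
Proof.
case: s => [|i0 s'] us sv.
  case: v sv => // _; rewrite big_nil -(probability_setT P).
  by congr (P _); apply/seteqP; split.
case: v sv => // v0 v' sv; move: (i0 :: s') (v0 :: v') us sv => s v us sv.
have := @indepF _ (tnth (in_tuple s)) _ (fun j => nth v0 v j).
rewrite [X in P X](_ : _ = [set w | [seq F i w | i <- s] = v]); last first.
  apply/seteqP; split=> w /= => [h|h j].
    apply: (@eq_from_nth _ v0) => [|j]; rewrite size_map// => js.
    by rewrite -(h (Ordinal js)) (nth_map i0)// (tnth_nth i0).
  by rewrite -h (tnth_nth i0) (nth_map i0).
move=> ->; last by apply/tuple_uniqP.
rewrite (big_nth (i0, v0)) size_zip -sv minnn big_mkord.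
by apply: eq_bigr => j _; rewrite nth_zip//= (tnth_nth i0).
Qed.

Lemma indep_seq_cat (s1 s2 : seq I) (A1 A2 : set (seq V)) : uniq (s1 ++ s2) ->
  P [set w | A1 [seq F i w | i <- s1] /\ A2 [seq F i w | i <- s2]] =
  P [set w | A1 [seq F i w | i <- s1]] * P [set w | A2 [seq F i w | i <- s2]].
Proof.
move=> us; have mmap s : discrete_rv (fun w => [seq F i w | i <- s]).
  by apply: discrete_rv_map.
apply: indep_event => // v1 v2.
have [sv1|sv1] := eqVneq (size s1) (size v1); last first.
  rewrite [X in P X = _](_ : _ = set0) ?[X in P X * _](_ : _ = set0).
  - by rewrite measure0 mul0e.
  - apply/seteqP; split=> // w /= e.
    by move: sv1; rewrite -e size_map eqxx.
  - apply/seteqP; split=> // w /= [e _].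
    by move: sv1; rewrite -e size_map eqxx.
have [sv2|sv2] := eqVneq (size s2) (size v2); last first.
  rewrite [X in P X = _](_ : _ = set0) ?[X in _ * P X](_ : _ = set0).
  - by rewrite measure0 mule0.
  - apply/seteqP; split=> // w /= e.
    by move: sv2; rewrite -e size_map eqxx.
  - apply/seteqP; split=> // w /= [_ e].
    by move: sv2; rewrite -e size_map eqxx.
move: (us); rewrite cat_uniq => /and3P[us1 _ us2].
rewrite [RHS]muleC indep_seq// muleC indep_seq// -big_cat -zip_cat//.
rewrite -indep_seq// ?size_cat ?sv1 ?sv2//; congr (P _).
apply/seteqP; split=> w /=; rewrite map_cat; first by case=> -> ->.
move/eqP; by rewrite eqseq_cat ?size_map// => /andP[/eqP -> /eqP ->].
Qed.

Definition block_event (bs : seq (seq I * set (seq V))) (w : T) : Prop :=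
  foldr (fun b Q => b.2 [seq F i w | i <- b.1] /\ Q) True bs.

Lemma indep_blocks (bs : seq (seq I * set (seq V))) :
  uniq (flatten [seq b.1 | b <- bs]) ->
  P [set w | block_event bs w] =
  \prod_(b <- bs) P [set w | b.2 [seq F i w | i <- b.1]].
Proof.
(* The conditions on all remaining blocks are reread as one condition on the concatenated list of
   values, cut according to block lengths, so that independence of two lists suffices for the
   induction. *)
pose on_flatten := fix on_flatten (bs : seq (seq I * set (seq V))) (v : seq V) : Prop :=
  if bs is b :: bs' then
    b.2 (take (size b.1) v) /\ on_flatten bs' (drop (size b.1) v)
  else True.
have on_flattenE bs' w : block_event bs' w =
    on_flatten bs' [seq F i w | i <- flatten [seq b.1 | b <- bs']].
  elim: bs' => //= b bs' ->; rewrite map_cat.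
  by rewrite take_size_cat ?drop_size_cat ?size_map.
elim: bs => [_|b bs IH us].
  by rewrite big_nil -(probability_setT P); congr (P _); apply/seteqP; split.
move: (us); rewrite cat_uniq => /and3P[_ _ /IH {}IH].
rewrite big_cons -IH (_ : [set w | block_event bs w] = [set w | on_flatten bs
  [seq F i w | i <- flatten [seq b.1 | b <- bs]]]); last first.
  by apply/seteqP; split=> w /=; rewrite on_flattenE.
rewrite -(@indep_seq_cat _ _ b.2)//; congr (P _).
by apply/seteqP; split=> w /=; rewrite on_flattenE.
Qed.

(** The map [c] sorts the indices into classes of equal law; under independence the joint law of a
    list depends only on its list of classes. This moves the variables of one time step to
    another. *)
Lemma indep_seq_law {K : Type} (c : I -> K) (law : K -> V -> \bar R) (s s' : seq I)
    (A : set (seq V)) :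
  (forall i v, P [set w | F i w = v] = law (c i) v) ->
  uniq s -> uniq s' -> map c s = map c s' ->
  P [set w | A [seq F i w | i <- s]] = P [set w | A [seq F i w | i <- s']].
Proof.
move=> Fc us us' ss'; have ss : size s = size s'.
  by rewrite -(size_map c s) ss' size_map.
have mmap r : discrete_rv (fun w => [seq F i w | i <- r]).
  by apply: discrete_rv_map.
rewrite (prob_event P A (mmap s)) (prob_event P A (mmap s')).
apply: eq_esum => v _.
have [sv|sv] := eqVneq (size s) (size v); last first.
  rewrite [X in P X = _](_ : _ = set0) ?[X in _ = P X](_ : _ = set0)//.
    apply/seteqP; split=> // w /= e.
    by move: sv; rewrite -e size_map ss eqxx.
  apply/seteqP; split=> // w /= e.
  by move: sv; rewrite -e size_map eqxx.
rewrite !indep_seq// -?ss//.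
have prodE r u : size r = size u -> \prod_(p <- zip r u) P [set w | F p.1 w = p.2] =
    \prod_(p <- zip (map c r) u) law p.1 p.2.
  elim: r u => [|i r IH] [|x u]//= => [|[rv]]; first by rewrite !big_nil.
  by rewrite !big_cons IH//= Fc.
by rewrite !prodE -?ss// ss'.
Qed.

End Independence.

(** * Path laws as products of transition weights, and their composition *)

Section Chain.
Context {R : realType}.
Local Open Scope ereal_scope.

(** Times and states enter symmetrically, so a state path of one chain can be the time path of
    another. The value [0] on lists of different lengths matches the empty event in [fdd]. *)
Fixpoint chain {I C : Type} (K : I -> C -> I -> C -> \bar R) (t0 : I) (x0 : C)
    (ts : seq I) (xs : seq C) : \bar R :=
  match ts, xs with
  | [::], [::] => 1
  | t :: ts', x :: xs' => K t0 x0 t x * chain K t x ts' xs'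
  | _, _ => 0
  end.

Lemma chain_ge0 {I C : Type} (K : I -> C -> I -> C -> \bar R) t0 x0 ts xs :
  (forall t x t' x', 0 <= K t x t' x') -> 0 <= chain K t0 x0 ts xs.
Proof.
move=> K0; elim: ts t0 x0 xs => [|t ts IH] t0 x0 [|x xs]//=.
exact: mule_ge0.
Qed.

(* The middle path [xs] is the state path of the first chain and the time path
   of the second one. *)
Lemma chain_comp {I J : Type} {C : choiceType}
    (K : I -> C -> I -> C -> \bar R) (L : C -> J -> C -> J -> \bar R)
    (M : I -> J -> I -> J -> \bar R) t0 x0 j0 ts js :
  (forall t x t' x', 0 <= K t x t' x') -> (forall t x t' x', 0 <= L t x t' x') ->
  (forall t x t' j j', \esum_(x' in [set: C]) (K t x t' x' * L x j x' j') =
     M t j t' j') ->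
  \esum_(xs in [set: seq C]) (chain K t0 x0 ts xs * chain L x0 j0 xs js) =
  chain M t0 j0 ts js.
Proof.
move=> K0 L0 KLM; have ch0 s s' t x0' j0' ts' :
    0 <= chain K t x0' ts' s * chain L x0' j0' s s'.
  by apply: mule_ge0; exact: chain_ge0.
elim: ts t0 x0 j0 js => [|t ts IH] t0 x0 j0 js.
  rewrite (esum_delta (i0 := [::])).
  - by case: js => [|j js] /=; rewrite mul1e.
  - exact: ch0.
  - by case=> [//|x xs _] /=; rewrite mul0e.
rewrite esum_seq => [|s|]; [|exact: ch0|by rewrite mul0e].
case: js => [|j js] /=.
  by apply: esum1 => x _; apply: esum1 => s _; rewrite mule0.
under eq_esum => x _.
  under eq_esum => s _ do rewrite muleACA.
  rewrite esumZ; [|exact: mule_ge0|by move=> s; exact: ch0].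
  rewrite IH muleC.
  over.
have M0 : 0 <= chain M t j ts js by rewrite -(IH _ x0); apply: esum_ge0.
by rewrite esumZ// ?KLM 1?muleC// => x; exact: mule_ge0.
Qed.

(** The kernel of a walk with nonnegative jumps of law [q]; the guard excludes downward moves, which
    truncated subtraction would count as a jump [0]. *)
Definition step (q : nat -> \bar R) (k0 k : nat) : \bar R :=
  if (k0 <= k)%N then q (k - k0)%N else 0.

Lemma step_ge0 q k0 k : (forall n, 0 <= q n) -> 0 <= step q k0 k.
Proof. by move=> q0; rewrite /step; case: ifP. Qed.

Lemma esum_step (p : nat -> \bar R) (f : nat -> \bar R) x0 :
  (forall n, 0 <= p n) -> (forall n, 0 <= f n) ->
  \esum_(x in [set: nat]) (step p x0 x * f (x - x0)%N) =
  \esum_(x in [set: nat]) (p x * f x).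
Proof.
move=> p0 f0; rewrite -(esum_shift x0 (f := fun x => p x * f x)) => [|n]; last exact: mule_ge0.
by apply: eq_esum => x _; rewrite /step; case: ifP; rewrite ?mul0e.
Qed.

(** Translating the sum by [x0] shows that the result does not depend on the starting state [x0],
    which is the compatibility condition of [chain_comp]. *)
Lemma step_comp (p : nat -> \bar R) (q : nat -> nat -> \bar R) x0 k0 k :
  (forall n, 0 <= p n) -> (forall n j, 0 <= q n j) ->
  \esum_(x in [set: nat]) (step p x0 x * step (q (x - x0)%N) k0 k) =
  step (fun j => \esum_(n in [set: nat]) (p n * q n j)) k0 k.
Proof.
move=> p0 q0; rewrite (esum_step (f := fun n => step (q n) k0 k))//; last first.
  by move=> n; apply: step_ge0.
by rewrite /step; case: ifP => // _; apply: esum1 => x _; rewrite mule0.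
Qed.

End Chain.

(** * Probability generating functions and their uniqueness *)

Section Pgf.
Context {R : realType}.
Local Open Scope ereal_scope.

(** After cancelling the equal coefficients below [k], the term [s ^+ k * a k] is at most
    [s ^+ k * b k] plus a tail bounded by [s ^+ k.+1], because the [b j] sum to at most [1].
    Dividing by [s ^+ k] leaves an error [s], which is arbitrarily small. The inequality is
    one-sided so that symmetry yields equality. *)
Lemma pgf_coef_le (a b : nat -> R) : (forall k, 0 <= a k)%R -> (forall k, 0 <= b k)%R ->
  \esum_(k in [set: nat]) (b k)%:E <= 1 ->
  (forall s : R, 0 < s < 1 -> \esum_(k in [set: nat]) (s ^+ k * a k)%:E =
     \esum_(k in [set: nat]) (s ^+ k * b k)%:E)%R ->
  forall k, (forall j, (j < k)%N -> a j = b j) -> (a k <= b k)%R.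
Proof.
move=> a0 b0 b1 ab k IH.
have key (s : R) : (0 < s < 1)%R -> (a k <= b k + s)%R.
  move=> /andP[s0 s1].
  have sa0 n : (0 <= s ^+ n * a n)%R by rewrite mulr_ge0// exprn_ge0// ltW.
  have sb0 n : (0 <= s ^+ n * b n)%R by rewrite mulr_ge0// exprn_ge0// ltW.
  have := ab s; rewrite s0 s1 => /(_ erefl).
  rewrite -!nneseries_esumT; [|by move=> n; rewrite lee_fin..].
  rewrite (nneseries_split 0 k.+1); last by move=> n _; rewrite lee_fin.
  rewrite [RHS](nneseries_split 0 k.+1); last by move=> n _; rewrite lee_fin.
  rewrite add0n !sumEFin !big_nat_recr//= => eqs.
  have tail_le : \sum_(k.+1 <= j <oo) (s ^+ j * b j)%:E <= (s ^+ k.+1)%:E.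
    apply: (@le_trans _ _ (\sum_(k.+1 <= j <oo) (s ^+ k.+1)%:E * (b j)%:E)).
      rewrite [leLHS]eseries_cond [leRHS]eseries_cond.
      apply: lee_nneseries => [j _ _|j /andP[_ kj]].
        by rewrite lee_fin.
      rewrite -EFinM lee_fin ler_wpM2r// ler_wiXn2l//; exact: ltW.
    rewrite nneseriesZl => [|j _]; last by rewrite lee_fin.
    rewrite -[leRHS]mule1; apply: lee_wpmul2l; first by rewrite lee_fin exprn_ge0// ltW.
    apply: le_trans b1; rewrite -nneseries_esumT; last by move=> n; rewrite lee_fin.
    rewrite [leRHS](nneseries_split 0 k.+1); last by move=> n _; rewrite lee_fin.
    by rewrite add0n leeDr// sumEFin lee_fin sumr_ge0.
  have : ((\sum_(0 <= i < k) s ^+ i * a i + s ^+ k * a k)%:E <=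
      (\sum_(0 <= i < k) s ^+ i * b i + s ^+ k * b k)%:E + (s ^+ k.+1)%:E).
    apply: (@le_trans _ _ ((\sum_(0 <= i < k) s ^+ i * b i + s ^+ k * b k)%:E +
      \sum_(k.+1 <= j <oo) (s ^+ j * b j)%:E)); last exact: leeD2l.
    by rewrite -eqs leeDl// nneseries_ge0// => n _ _; rewrite lee_fin.
  rewrite -EFinD lee_fin (eq_big_nat _ _ (F2 := fun i => (s ^+ i * b i)%R)); last first.
    by move=> i /andP[_ ik]; rewrite IH.
  by rewrite -addrA lerD2l exprSr -mulrDr ler_pM2l// exprn_gt0.
apply/ler_addgt0Pr => e e0.
apply: (@le_trans _ _ (b k + Num.min e 2^-1)%R).
  apply: key; rewrite lt_min e0 invr_gt0 ltr0n/= gt_min.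
  by rewrite invf_lt1 ?ltr1n ?orbT.
by rewrite lerD2l ge_min lexx.
Qed.

Lemma pgf_coef_inj (a b : nat -> R) : (forall k, 0 <= a k)%R -> (forall k, 0 <= b k)%R ->
  \esum_(k in [set: nat]) (a k)%:E <= 1 ->
  \esum_(k in [set: nat]) (b k)%:E <= 1 ->
  (forall s : R, 0 < s < 1 -> \esum_(k in [set: nat]) (s ^+ k * a k)%:E =
     \esum_(k in [set: nat]) (s ^+ k * b k)%:E)%R ->
  a =1 b.
Proof.
move=> a0 b0 a1 b1 ab k; elim/ltn_ind: k => k IH.
apply/eqP; rewrite eq_le; apply/andP; split; apply: pgf_coef_le => //.
  by move=> s s01; rewrite ab.
by move=> j jk; rewrite IH.
Qed.

Context {d : measure_display} {T : measurableType d} (P : probability T R).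
Variable U : T -> nat.
Hypothesis mU : discrete_rv U.

Lemma law_sum1 : \esum_(k in [set: nat]) P [set w | U w = k] = 1.
Proof.
rewrite -(prob_event P [set: nat] mU) -(probability_setT P).
by congr (P _); apply/seteqP; split.
Qed.

(** The integrand is at most [1], so the integral is finite and [fine] in [pgf] loses nothing. *)
Lemma pgf_esum (s : R) : (0 <= s <= 1)%R ->
  (pgf P U s)%:E = \esum_(k in [set: nat]) ((s ^+ k)%:E * P [set w | U w = k]).
Proof.
move=> /andP[s0 s1]; rewrite -(expectation_esum P (f := fun k => s ^+ k)%R)//; last first.
  by move=> k; exact: exprn_ge0.
rewrite /pgf fineK// ge0_fin_numE; last first.
  by apply: integral_ge0 => w _; rewrite lee_fin exprn_ge0.
apply: (@le_lt_trans _ _ (\int[P]_w (cst 1 w))).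
  apply: ge0_le_integral => //.
  - by move=> w _; rewrite lee_fin exprn_ge0.
  - exact: (discrete_rv_measurable_fun (fun k => s ^+ k)%R).
  - by move=> w _; rewrite lee_fin exprn_ile1.
rewrite integral_cst// mul1e.
by rewrite (le_lt_trans (probability_le1 P measurableT))// ltry.
Qed.

Lemma pgf_ge0 (s : R) : (0 <= s <= 1)%R -> (0 <= pgf P U s)%R.
Proof.
move=> /andP[s0 s1]; rewrite fine_ge0//.
by apply: integral_ge0 => w _; rewrite lee_fin exprn_ge0.
Qed.

Lemma pgf_le1 (s : R) : (0 <= s <= 1)%R -> (pgf P U s <= 1)%R.
Proof.
move=> s01; rewrite -lee_fin pgf_esum// -law_sum1; apply: le_esum => k _.
case/andP: s01 => s0 s1.
rewrite -[leRHS]mul1e; apply: lee_wpmul2r => //.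
by rewrite lee_fin exprn_ile1.
Qed.

(** A zero value would annihilate every term [s ^+ k * P (U = k)], hence the total mass. At [s = 0]
    only the mass at [0] survives, and positivity there is a property of Lévy processes, proved
    separately. *)
Lemma pgf_gt0 (s : R) : (0 < s <= 1)%R -> (0 < pgf P U s)%R.
Proof.
move=> /andP[s0 s1]; have s01 : (0 <= s <= 1)%R by rewrite ltW.
rewrite lt_def pgf_ge0// andbT.
apply/negP => /eqP pgf0.
have : forall k, P [set w | U w = k] = 0.
  move=> k; apply/eqP; rewrite eq_le measure_ge0 andbT.
  have : (s ^+ k)%:E * P [set w | U w = k] <= (pgf P U s)%:E.
    rewrite pgf_esum//; apply: esum_ge; exists [set k] => //.
    by rewrite fsbig_set1.
  by rewrite pgf0 pmule_rle0// lte_fin exprn_gt0.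
move=> P0; have := law_sum1; rewrite esum1// => /eqP.
by rewrite eq_sym onee_eq0.
Qed.

(** Since [0 ^+ 0 = 1], the value at [0] is the mass at [0]; when that vanishes, only powers
    [s ^+ k <= s] with [k >= 1] remain. *)
Lemma pgf_le_arg (s : R) : (0 <= s <= 1)%R -> pgf P U 0 = 0%R -> (pgf P U s <= s)%R.
Proof.
move=> s01 pgf0; case/andP: (s01) => s0 s1.
have zero01 : (0 <= (0 : R) <= 1)%R by rewrite lexx ler01.
have p0 : P [set w | U w = 0%N] = 0.
  have := pgf_esum zero01; rewrite pgf0 (esum_delta (i0 := 0%N)).
  - by rewrite expr0 mul1e.
  - by rewrite expr0 mul1e.
  - by case=> // k _; rewrite expr0n mul0e.
rewrite -lee_fin pgf_esum// -[leRHS]mule1 -law_sum1 -esumZ ?lee_fin//.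
apply: le_esum => -[_|k _]; first by rewrite p0 !mule0.
by apply: lee_wpmul2r => //; rewrite lee_fin exprS ler_piMr// exprn_ile1.
Qed.

End Pgf.

Lemma pgf_inj {R : realType} {d d' : measure_display} {T : measurableType d}
    {T' : measurableType d'} (P : probability T R) (P' : probability T' R)
    (U : T -> nat) (V : T' -> nat) : discrete_rv U -> discrete_rv V ->
  (forall s : R, 0 < s < 1 -> pgf P U s = pgf P' V s) ->
  forall k, P [set w | U w = k] = P' [set w | V w = k].
Proof.
move=> mU mV UV k.
have fP k' : (P [set w | U w = k'] = (fine (P [set w | U w = k']))%:E)%E.
  by rewrite fineK// fin_num_measure.
have fP' k' : (P' [set w | V w = k'] = (fine (P' [set w | V w = k']))%:E)%E.
  by rewrite fineK// fin_num_measure.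
rewrite fP fP'; congr (_%:E).
apply: (@pgf_coef_inj _ (fun k => fine (P [set w | U w = k]))
  (fun k => fine (P' [set w | V w = k]))).
- by move=> j; exact: fine_ge0.
- by move=> j; exact: fine_ge0.
- by under eq_esum => j _ do rewrite -fP; rewrite law_sum1.
- by under eq_esum => j _ do rewrite -fP'; rewrite law_sum1.
move=> s s01; have s01' : 0 <= s <= 1 by case/andP: s01 => /ltW -> /ltW ->.
transitivity (pgf P U s)%:E.
  by rewrite pgf_esum//; apply: eq_esum => j _; rewrite EFinM -fP.
by rewrite UV// pgf_esum//; apply: eq_esum => j _; rewrite EFinM -fP'.
Qed.

(** * Almost sure equality of events, and generating functions of independent sums *)

Section AlmostSure.
Context {R : realType} {d : measure_display} {T : measurableType d}.
Variable P : probability T R.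
Local Open Scope ereal_scope.

Lemma prob1_ae (A : set T) : measurable A -> P A = 1 -> \forall w \ae P, A w.
Proof.
move=> mA PA; exists (~` A); split => //; first exact: measurableC.
by rewrite probability_setC// PA subee.
Qed.

Lemma prob_ae_eq (A B : set T) : measurable A -> measurable B ->
  (\forall w \ae P, A w <-> B w) -> P A = P B.
Proof.
move=> mA mB [N [mN N0 ABN]].
rewrite -(measureU0 (mu := P) mA mN N0) -(measureU0 (mu := P) mB mN N0); congr (P _).
have ABN' w : ~ N w -> (A w <-> B w).
  by move=> Nw; apply: contrapT => h; apply: Nw; exact: ABN.
apply/seteqP; split=> w /= [|Nw]; [|by right| |by right].
  by move=> Aw; have [|/ABN' h] := pselect (N w); [right|left; apply/h].
by move=> Aw; have [|/ABN' h] := pselect (N w); [right|left; apply/h].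
Qed.

Lemma esum_finType (C : finType) (a : C -> \bar R) : (forall i, 0 <= a i) ->
  \esum_(i in [set: C]) a i = \sum_(i : C) a i.
Proof.
move=> a0; rewrite esum_fset//; last exact: finite_finset.
rewrite (fsbigE (index_enum C)) ?index_enum_uniq//.
  by apply: eq_bigl => i; rewrite in_setT.
by move=> i _; rewrite mem_index_enum.
Qed.

Lemma pgfD (U V : T -> nat) (s : R) : discrete_rv U -> discrete_rv V ->
  (forall a b, P [set w | U w = a /\ V w = b] =
     P [set w | U w = a] * P [set w | V w = b]) ->
  (0 <= s <= 1)%R ->
  pgf P (fun w => U w + V w)%N s = (pgf P U s * pgf P V s)%R.
Proof.
move=> mU mV UV s01; have mUV := discrete_rv_pair mU mV.
have s0 k : (0 <= s ^+ k)%R by case/andP: s01 => *; exact: exprn_ge0.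
have -> : pgf P (fun w => U w + V w)%N s =
    fine (\int[P]_w ((fun c : nat * nat => s ^+ (c.1 + c.2))%R (U w, V w))%:E) by [].
rewrite (expectation_esum P (f := fun c : nat * nat => s ^+ (c.1 + c.2))%R mUV)//.
apply: EFin_inj; rewrite EFinM !pgf_esum//.
rewrite -[in RHS]esumZ; last 2 first.
- by apply: esum_ge0 => k _; rewrite mule_ge0// lee_fin.
- by move=> k; rewrite mule_ge0// lee_fin.
rewrite fineK; last first.
  rewrite -(expectation_esum P (f := fun c : nat * nat => s ^+ (c.1 + c.2))%R mUV)//.
  rewrite ge0_fin_numE; last by apply: integral_ge0 => w _; rewrite lee_fin.
  apply: (@le_lt_trans _ _ (\int[P]_w (cst 1 w))).
    apply: ge0_le_integral => //.
    - by move=> w _; rewrite lee_fin.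
    - exact: (discrete_rv_measurable_fun (fun c : nat * nat => s ^+ (c.1 + c.2))%R mUV).
    - by move=> w _; rewrite lee_fin; case/andP: s01 => *; exact: exprn_ile1.
  rewrite integral_cst// mul1e.
  by rewrite (le_lt_trans (probability_le1 P measurableT))// ltry.
transitivity (\esum_(j in [set: nat]) \esum_(i in [set: nat])
    ((s ^+ i)%:E * P [set w | U w = i] * ((s ^+ j)%:E * P [set w | V w = j]))); last first.
  apply: eq_esum => j _; rewrite [RHS]muleC -esumZ.
  - by apply: eq_esum => i _; rewrite muleC.
  - by rewrite mule_ge0// lee_fin.
  - by move=> i; rewrite mule_ge0// lee_fin.
rewrite esum_exchange; last first.
  by move=> i j; rewrite !mule_ge0// lee_fin.
rewrite esum_esum => [|i j _ _]; last by rewrite !mule_ge0// lee_fin.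
rewrite [RHS](_ : _ = \esum_(k in [set: nat * nat]) ((s ^+ k.1)%:E *
    P [set w | U w = k.1] * ((s ^+ k.2)%:E * P [set w | V w = k.2]))); last first.
  by congr esum; apply/seteqP; split.
apply: eq_esum => -[i j] _ /=; rewrite muleACA -UV -EFinM -exprD; congr (_ * P _).
by apply/seteqP; split=> w /= [-> ->].
Qed.

End AlmostSure.

Lemma map_all2P (C D : eqType) (f g : C -> D) (s : seq C) (v : seq D) :
  {in s, f =1 g} -> [seq f x | x <- s] = v <-> all2 (fun x y => g x == y) s v.
Proof.
elim: s v => [|x s IH] [|y v]//= fg.
have {}IH : [seq f x | x <- s] = v <-> all2 (fun x y => g x == y) s v.
  by apply: IH => z zs; apply: fg; rewrite in_cons zs orbT.
rewrite -fg ?mem_head//; split=> [[/eqP -> /IH ->]//|/andP[/eqP -> /IH ->]//].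
Qed.

(** * Binomial thinning realized by partial sums of Bernoulli variables *)

Section Thinning.
Context {R : realType} {d : measure_display} {T : measurableType d}.
Variables (P : probability T R) (b : R) (Y : nat -> T -> nat).
Hypothesis mY : forall i, discrete_rv (Y i).
Hypothesis indepY : mutually_indep P Y.
Hypothesis Y1 : forall i, P [set w | Y i w = 1%N] = b%:E.
Hypothesis Y0 : forall i, P [set w | Y i w = 0%N] = (1 - b)%:E.
Local Open Scope ereal_scope.

Let S (x : nat) (w : T) : nat := (\sum_(i < x) Y i w)%N.

(** The masses at [0] and [1] already add up to [1]. Other values remain possible on a null set, so
    every comparison with a Boolean pattern below is almost sure only. *)
Lemma bernoulli_ae i : \forall w \ae P, (Y i w <= 1)%N.
Proof.
apply: prob1_ae; first exact: (discrete_rv_event (U := Y i) [set k | (k <= 1)%N]).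
have Y01 : [set w | Y i w = 0%N] `&` [set w | Y i w = 1%N] = set0.
  by apply/seteqP; split=> // w /= [->].
rewrite (_ : (fun w => _) = [set w | Y i w = 0%N] `|` [set w | Y i w = 1%N]).
  rewrite measureU//; [|exact: mY|exact: mY].
  by rewrite [X in (X + _)%R = _](Y0 i) [X in (_ + X)%R = _](Y1 i) -EFinD subrK.
apply/seteqP; split=> w /=; first by case: (Y i w) => [|[|]]//; [left|right].
by case=> ->.
Qed.

Lemma thinned_sumn x w : S x w = sumn [seq Y i w | i <- iota 0 x].
Proof. by rewrite /S sumnE big_map -[iota 0 x](_ : index_iota 0 x = _) ?big_mkord// /index_iota subn0. Qed.

Lemma discrete_rv_thinned x : discrete_rv (S x).
Proof.
rewrite (_ : S x = fun w => sumn [seq Y i w | i <- iota 0 x]).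
  apply: (@discrete_rv_comp _ _ _ _ (fun w => [seq Y i w | i <- iota 0 x]) sumn).
  exact: discrete_rv_map.
by apply/funext => w; rewrite thinned_sumn.
Qed.

(** The finite sum defining [thin_prob] is the decomposition of this event by the Boolean pattern
    [B] of the first [N] variables, whose law is a product by independence. *)
Lemma thin_probE xs ks :
  (thin_prob b xs ks)%:E = P [set w | [seq S x w | x <- xs] = ks].
Proof.
rewrite /thin_prob; set N := (\max_(x <- xs) x)%N.
pose B w := [ffun i : 'I_N => Y i w == 1%N].
pose Q (y : {ffun 'I_N -> bool}) := all2 (fun x k =>
  (\sum_(i < N | (i < x)%N) nat_of_bool (y i))%N == k) xs ks.
have mB : discrete_rv B.
  move=> y; rewrite (_ : [set w | B w = y] = \bigcap_(i in [set: 'I_N]) [set w | (Y i w == 1%N) = y i]).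
    apply: fin_bigcap_measurable => // i _.
    exact: (discrete_rv_comp (fun k => k == 1%N) (mY i)).
  apply/seteqP; split=> [w <- i _|w h] /=; first by rewrite ffunE.
  by apply/ffunP => i; rewrite ffunE h.
have mS : discrete_rv (fun w => [seq S x w | x <- xs]).
  by apply: discrete_rv_map => x _; exact: discrete_rv_thinned.
have Yae : \forall w \ae P, forall i, (Y i w <= 1)%N.
  by apply: ae_foralln => i; exact: bernoulli_ae.
have PB y : P [set w | B w = y] = (\prod_(i < N) (if y i then b else 1 - b))%:E.
  transitivity (P [set w | forall i : 'I_N, Y i w = y i]).
    apply: prob_ae_eq; [exact: mB| |].
      rewrite (_ : mkset _ = \bigcap_(i in [set: 'I_N]) [set w | Y i w = y i]).
        by apply: fin_bigcap_measurable => // i _; exact: mY.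
      by apply/seteqP; split=> [w h i _|w h i] /=; exact: h.
    apply: filterS Yae => w Yw; split=> [<- i|h]; last first.
      by apply/ffunP => i; rewrite ffunE h; case: (y i).
    by rewrite ffunE; case: (Y i w) (Yw i) => [|[|]].
  rewrite (indepY (n := N) (f := fun i => i : nat) _ (fun i => y i : nat)); last exact: val_inj.
  by rewrite -prodEFin; apply: eq_bigr => i _; case: (y i).
have -> : P [set w | [seq S x w | x <- xs] = ks] = P [set w | Q (B w)].
  apply: prob_ae_eq; [exact: mS|exact: (discrete_rv_event (U := B) Q)|].
  apply: filterS Yae => w Yw; rewrite /Q.
  have SE x : x \in xs -> S x w = (\sum_(i < N | (i < x)%N) nat_of_bool (B w i))%N.
    move=> xxs; have xN : (x <= N)%N by rewrite /N; exact: leq_bigmax_seq.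
    rewrite /S (big_ord_widen _ (fun i => Y i w) xN); apply: eq_bigr => i _.
    by rewrite ffunE; case: (Y i w) (Yw i) => [|[|]].
  exact: map_all2P.
rewrite (prob_event P Q mB) esum_mkcond esum_finType => [|y]; last by case: ifP.
rewrite -sumEFin; apply: eq_bigr => y _; rewrite EFinM -PB mem_setE.
by rewrite /in_mem /= -/(Q y); case: (Q y); rewrite ?mule1 ?mule0.
Qed.

Lemma indep_thinnedS x a k : P [set w | S x w = a /\ Y x w = k] =
  P [set w | S x w = a] * P [set w | Y x w = k].
Proof.
rewrite (_ : [set w | S x w = a] = [set w | (fun v => sumn v = a) [seq Y i w | i <- iota 0 x]]); last first.
  by apply/seteqP; split=> w /=; rewrite thinned_sumn.
rewrite (_ : [set w | Y x w = k] = [set w | (fun v => v = [:: k]) [seq Y i w | i <- [:: x]]]); last first.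
  by apply/seteqP; split=> w /= => [->|[]].
rewrite -(indep_seq_cat indepY mY (fun v => sumn v = a) (fun v => v = [:: k])); last first.
  by rewrite -[x in [:: x]](add0n x) -[[:: _]]/(iota (0 + x) 1) -iotaD iota_uniq.
by congr (P _); apply/seteqP; split=> w /=; rewrite thinned_sumn => -[-> ]; [move=> ->|case=> ->].
Qed.

Lemma pgf_bernoulli i (s : R) : (0 <= s <= 1)%R -> pgf P (Y i) s = (1 - b + b * s)%R.
Proof.
move=> s01; apply: EFin_inj; rewrite (pgf_esum P (mY i) s01).
have s0 k : (0 <= s ^+ k)%R by case/andP: s01 => *; exact: exprn_ge0.
rewrite -nneseries_esumT => [|k]; last by rewrite mule_ge0// lee_fin.
rewrite (nneseries_split 0 2) => [|k _]; last by rewrite mule_ge0// lee_fin.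
rewrite eseries0 => [|k k2 _].
  rewrite adde0 !big_nat_recr//= big_nil.
  by rewrite add0r Y0 Y1 -!EFinM -EFinD expr0 mul1r expr1 (mulrC s).
rewrite [P _](_ : _ = 0) ?mule0//; apply/eqP; rewrite eq_le measure_ge0 andbT.
rewrite -(measure0 P) (@prob_ae_eq _ _ _ P _ set0)//; first exact: mY.
apply: filterS (bernoulli_ae i) => w Yw; split=> //= Yk.
by move: k2; rewrite -Yk leqNgt ltnS Yw.
Qed.

Lemma pgf_thinned x (s : R) : (0 <= s <= 1)%R ->
  pgf P (S x) s = ((1 - b + b * s) ^+ x)%R.
Proof.
move=> s01; elim: x => [|x IH].
  rewrite /pgf /S; under eq_integral do rewrite big_ord0 expr0.
  by rewrite integral_cst//= mul1e probability_setT expr0.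
rewrite (_ : S x.+1 = fun w => S x w + Y x w)%N; last first.
  by apply/funext => w; rewrite /S big_ord_recr.
rewrite pgfD//; [|exact: discrete_rv_thinned|exact: indep_thinnedS].
by rewrite IH pgf_bernoulli// exprSr.
Qed.

(** The population size plays the role of time: the partial sums are a random walk indexed by the
    size. *)
Definition thin_kernel (x0 k0 x k : nat) : \bar R :=
  step (fun j => P [set w | S (x - x0) w = j]) k0 k.

(** The variables with indices from [x0] to [x] give the first increment, and those from [x] to the
    maximum [M] determine all later ones. The two blocks are disjoint, hence independent, and the
    first has the law of an initial block of the same length. *)
Lemma fdd_thinned_from x0 k0 xs ks : path leq x0 xs ->
  P [set w | [seq k0 + sumn [seq Y i w | i <- iota x0 (x - x0)] | x <- xs] = ks]%N =
  chain thin_kernel x0 k0 xs ks.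
Proof.
elim: xs x0 k0 ks => [|x xs IH] x0 k0 [|k ks]/=.
- by move=> _; rewrite -(probability_setT P); congr (P _); apply/seteqP; split.
- by move=> _; rewrite -(measure0 P); congr (P _); apply/seteqP; split.
- by move=> _; rewrite -(measure0 P); congr (P _); apply/seteqP; split.
move=> /andP[x0x pxs]; set M := (\max_(y <- xs) y)%N.
have xxs y : y \in xs -> (x <= y)%N.
  by move=> yxs; have := order_path_min leq_trans pxs => /allP; exact.
pose A1 v := (k0 + sumn v = k)%N.
pose A2 v := [seq (k + sumn (take (y - x) v))%N | y <- xs] = ks.
have A2E w : A2 [seq Y i w | i <- iota x (M - x)] =
    ([seq (k + sumn [seq Y i w | i <- iota x (y - x)])%N | y <- xs] = ks).
  rewrite /A2; congr (_ = _); apply/eq_in_map => y yxs; congr (_ + sumn _)%N.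
  rewrite -map_take take_iota; congr (map _ (iota _ _)).
  by apply/minn_idPl; apply: leq_sub2r; exact: leq_bigmax_seq.
transitivity (P [set w | A1 [seq Y i w | i <- iota x0 (x - x0)] /\
    A2 [seq Y i w | i <- iota x (M - x)]]).
  congr (P _); apply/seteqP; split=> w /=; rewrite A2E /A1.
    move=> [k1 <-]; split=> //; apply/eq_in_map => y yxs.
    rewrite -k1 -addnA -sumn_cat -map_cat -{2}(subnKC x0x) -iotaD.
    by rewrite [(x - x0 + _)%N]addnC addnBA// subnK// xxs.
  move=> [k1 <-]; congr (_ :: _) => //; apply/eq_in_map => y yxs.
  rewrite -k1 -addnA -sumn_cat -map_cat -{2}(subnKC x0x) -iotaD.
  by rewrite [(x - x0 + _)%N]addnC addnBA// subnK// xxs.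
rewrite (indep_seq_cat indepY mY A1 A2); last first.
  by rewrite -{2}(subnKC x0x) -iotaD iota_uniq.
congr (_ * _); last first.
  rewrite -IH//; congr (P _); apply/seteqP; split=> w /=; by rewrite A2E.
rewrite /thin_kernel /step /A1; case: leqP => k0k; last first.
  rewrite -(measure0 P); congr (P _); apply/seteqP; split=> // w /= kk.
  by move: k0k; rewrite -kk ltnNge leq_addr.
rewrite [RHS](_ : _ = P [set w | (fun v => sumn v = k - k0)%N [seq Y i w | i <- iota 0 (x - x0)]]); last first.
  by congr (P _); apply/seteqP; split=> w /=; rewrite thinned_sumn.
(* All the [Y i] share one law, so a single class suffices and only the lengths of the two blocks
   have to agree. *)
have := @indep_seq_law R d T P _ _ Y indepY mY unit (fun=> tt)
  (fun _ v => P [set w | Y 0%N w = v]) (iota x0 (x - x0)) (iota 0 (x - x0))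
  (fun v => sumn v = (k - k0)%N).
move=> <-; rewrite ?iota_uniq//.
- congr (P _); apply/seteqP; split=> w /=; first by move=> <-; rewrite addKn.
  by move=> ->; rewrite subnKC.
- move=> i v; have [v2|] := ltnP 1 v; last first.
    by case: v => [|[|]]// _; rewrite ?Y0 ?Y1.
  have null j : P [set w | Y j w = v] = 0.
    rewrite -(measure0 P) (@prob_ae_eq _ _ _ P _ set0)//; first exact: mY.
    apply: filterS (bernoulli_ae j) => w Yw; split=> //= Yk.
    by move: v2; rewrite -Yk ltnNge Yw.
  by rewrite !null.
- have cst_map m n : map (fun=> tt) (iota m n) = nseq n tt.
    by elim: n m => //= n IHn m; rewrite IHn.
  by rewrite !cst_map.
Qed.

Lemma fdd_thinned xs ks : path leq 0%N xs -> fdd P S xs ks = chain thin_kernel 0%N 0%N xs ks.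
Proof.
move=> /(fdd_thinned_from 0%N ks) <-; congr (P _); apply/seteqP; split=> w /=.
  by move=> <-; apply: eq_map => x; rewrite thinned_sumn subn0.
by move=> <-; apply: eq_map => x; rewrite thinned_sumn subn0.
Qed.

End Thinning.

(** The form in which [mutually_indep] delivers joint laws: entry [j] of [t0 :: ts] is the time
    preceding entry [j] of [ts], and likewise for states. *)
Lemma chain_prod {R : realType} {I C : Type} (K : I -> C -> I -> C -> \bar R)
    t0 x0 ts xs : size ts = size xs ->
  chain K t0 x0 ts xs = (\prod_(j < size ts)
    K (nth t0 (t0 :: ts) j) (nth x0 (x0 :: xs) j) (nth t0 ts j) (nth x0 xs j))%E.
Proof.
elim: ts t0 x0 xs => [|t ts IH] t0 x0 [|x xs]//= => [_|[sz]]; first by rewrite big_ord0.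
rewrite big_ord_recl IH//=; congr (_ * _)%E; apply: eq_bigr => j _.
have jts : (j < size ts)%N by [].
rewrite /bump/= !add0n !(set_nth_default t t0) ?(set_nth_default x x0)//= -?sz//.
- by rewrite ltnS ltnW.
- by rewrite ltnS ltnW.
Qed.

Lemma chain_size_neq {R : realType} {I C : Type} (K : I -> C -> I -> C -> \bar R)
    t0 x0 ts xs : size ts != size xs -> chain K t0 x0 ts xs = 0%E.
Proof.
elim: ts t0 x0 xs => [|t ts IH] t0 x0 [|x xs]//=.
by rewrite eqSS => /IH ->; rewrite mule0.
Qed.

(** * Cauchy's functional equation on the nonnegative half-line *)

Section Additive.
Context {R : realType}.

(** Additivity and nonnegativity make [g] monotone. Bracketing [n.+1%:R * t] between consecutive
    integers then brackets [n.+1%:R * g t] between consecutive multiples of [g 1], so [g t] differs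
    from [t * g 1] by at most [g 1 / n.+1%:R] for every [n]. *)
Lemma additive_nondecreasing_linear (g : R -> R) :
  (forall t h, 0 <= t -> 0 <= h -> g (t + h) = g t + g h) ->
  (forall t, 0 <= t -> 0 <= g t) ->
  forall t, 0 <= t -> g t = t * g 1.
Proof.
move=> gD g0; have g_le t u : 0 <= t <= u -> g t <= g u.
  move=> /andP[t0 tu]; rewrite -(subrK t u) addrC gD// ?subr_ge0//.
  by rewrite lerDl g0// subr_ge0.
have g00 : g 0 = 0 by have := gD 0 0 (lexx _) (lexx _); rewrite addr0 => /eqP; rewrite -subr_eq0 opprD addrA subrr sub0r oppr_eq0 => /eqP.
have gn n t : 0 <= t -> g (n%:R * t) = n%:R * g t.
  move=> t0; elim: n => [|n IH]; first by rewrite !mul0r.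
  by rewrite -natr1 !mulrDl !mul1r gD ?IH// mulr_ge0.
move=> t t0; have key n : `|g t - t * g 1| * n.+1%:R <= g 1.
  pose x := n.+1%:R * t; have x0 : 0 <= x by rewrite mulr_ge0.
  have /andP[mx xm] := truncn_itv x0.
  have gm : (Num.truncn x)%:R * g 1 <= n.+1%:R * g t.
    by rewrite -(gn n.+1 t)// -(gn (Num.truncn x) 1)// g_le// mulr1 ler0n.
  have gM : n.+1%:R * g t <= (Num.truncn x).+1%:R * g 1.
    by rewrite -(gn n.+1 t)// -(gn (Num.truncn x).+1 1)// g_le// mulr1 x0 ltW.
  have g1 : 0 <= g 1 by exact: g0.
  rewrite -(ger0_norm (ler0n R n.+1)) -normrM ler_norml.
  have mx1 : (Num.truncn x)%:R * g 1 <= x * g 1 by rewrite ler_wpM2r.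
  have xm1 : x * g 1 <= (Num.truncn x).+1%:R * g 1 by rewrite ler_wpM2r// ltW.
  rewrite -natr1 mulrDl mul1r in gM; rewrite -natr1 mulrDl mul1r in xm1.
  rewrite (mulrC (g t - _)) mulrBr mulrA -/x.
  by apply/andP; split; lra.
apply/eqP; rewrite -subr_eq0 -normr_eq0; apply/eqP/le_anti; rewrite normr_ge0 andbT.
rewrite leNgt; apply/negP => e0.
have := key (Num.truncn (g 1 / `|g t - t * g 1|)).
apply/negP; rewrite -ltNge mulrC -ltr_pdivrMr//.
exact: truncnS_gt.
Qed.

End Additive.

(** * Finite-dimensional laws and generating functions of a Lévy process *)

Section Levy.
Context {R : realType} {d : measure_display} {T : measurableType d}.
Variables (P : probability T R) (Z : R -> T -> nat).
Hypothesis levyZ : levy_process P Z.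
Local Open Scope ereal_scope.

Let mZ t : (0 <= t)%R -> discrete_rv (Z t).
Proof. by case: levyZ => + _ _ _; exact. Qed.

Lemma levy0_ae : \forall w \ae P, Z 0 w = 0%N.
Proof. by case: levyZ => _ Z0 _ _; apply: prob1_ae => //; exact: mZ. Qed.

Definition levy_kernel (t0 : R) (x0 : nat) (t : R) (x : nat) : \bar R :=
  step (fun j => P [set w | Z (t - t0) w = j]) x0 x.

(** [levy_process] speaks of integer differences. The law that stationarity assigns to them is that
    of a natural-valued variable, so negative differences have mass [0], in agreement with the guard
    of [step]. *)
Lemma levy_kernelE t0 x0 t x : levy_kernel t0 x0 t x =
  P [set w | (Z (t - t0) w)%:Z = x%:Z - x0%:Z]%R.
Proof.
rewrite /levy_kernel /step; case: leqP => x0x.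
  congr (P _); apply/seteqP; split=> w /=; rewrite subzn//.
    by move=> ->.
  by case.
rewrite -(measure0 P); congr (P _); apply/seteqP; split=> // w /= h.
have : (0 <= x%:Z - x0%:Z)%R by rewrite -h.
by rewrite subr_ge0 lez_nat leqNgt x0x.
Qed.

Lemma path_lt_nth (t0 : R) ts j : path <%R t0 ts -> (j < size ts)%N ->
  (nth t0 (t0 :: ts) j < nth t0 ts j)%R.
Proof. by move=> /(pathP t0); exact. Qed.

Lemma fdd_levy ts xs : path <%R 0%R ts -> fdd P Z ts xs = chain levy_kernel 0%R 0%N ts xs.
Proof.
move=> pts; have [sz|sz] := eqVneq (size ts) (size xs); last first.
  rewrite chain_size_neq// -(measure0 P); congr (P _).
  by apply/seteqP; split=> // w /= h; move: sz; rewrite -h size_map eqxx.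
(* Time [0] is prepended, so [m] observation times give [m] increments; as [Z 0 = 0] holds almost
   surely only, path and increments determine each other outside a null set. *)
pose m := size ts; pose tf (j : 'I_m.+1) := nth 0%R (0%R :: ts) j.
have nth_ge0 j : (0 <= nth 0 (0 :: ts) j)%R.
  have [jm|jm] := ltnP j m.+1; last by rewrite nth_default.
  have : (0%R :: ts)`_j \in (0%R :: ts) by rewrite mem_nth.
  rewrite in_cons => /predU1P[->//|]; move/(allP (order_path_min lt_trans pts)).
  exact: ltW.
have tfE (j : 'I_m) : tf (lift ord0 j) = nth 0%R ts j by rewrite /tf/= /bump/= add0n.
have ltf (j : 'I_m) : (tf (widen_ord (leqnSn m) j) < tf (lift ord0 j))%R.
  by rewrite tfE; exact: (path_lt_nth pts (ltn_ord j)).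
have [_ _ stat /(_ m tf) indep] := levyZ.
have {}indep := indep (lexx _) ltf m id (@inj_id _) (fun j => (nth 0%N xs j)%:Z - (nth 0%N (0%N :: xs) j)%:Z)%R.
rewrite chain_prod//.
transitivity (P [set w | forall j : 'I_m,
   ((Z (tf (lift ord0 j)) w)%:Z - (Z (tf (widen_ord (leqnSn m) j)) w)%:Z =
   (nth 0%N xs j)%:Z - (nth 0%N (0%N :: xs) j)%:Z)%R]).
  apply: prob_ae_eq.
  - apply: discrete_rv_map => t tts; apply: mZ; apply: ltW.
    exact: (allP (order_path_min lt_trans pts)).
  - rewrite (_ : mkset _ = \bigcap_(j in [set: 'I_m]) [set w |
     ((Z (tf (lift ord0 j)) w)%:Z - (Z (tf (widen_ord (leqnSn m) j)) w)%:Z =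
     (nth 0%N xs j)%:Z - (nth 0%N (0%N :: xs) j)%:Z)%R]); last first.
      by apply/seteqP; split=> [w h i _|w h i] /=; exact: h.
    apply: fin_bigcap_measurable => // j _.
    apply: (discrete_rv_event (U := fun w => (Z (tf (lift ord0 j)) w,
      Z (tf (widen_ord (leqnSn m) j)) w)) [set c | (c.1%:Z - c.2%:Z = _)%R]).
    by apply: discrete_rv_pair; apply: mZ; exact: nth_ge0.
  - apply: filterS levy0_ae => w Z0; split=> /= h.
      move=> j; rewrite tfE /tf/= -h (nth_map 0%R)//.
      congr (_ - _%:Z)%R; case: (nat_of_ord j) (ltn_ord j) => [|i] im /=; first by rewrite Z0.
      by rewrite (nth_map 0%R)// ltnW.
    apply: (@eq_from_nth _ 0%N) => [|j]; rewrite size_map// => jm.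
    rewrite (nth_map 0%R)//.
    (* The states are recovered from the increments one at a time, each from its predecessor,
       starting at [Z 0 w = 0]. *)
    have step_nth i : (i <= j)%N -> Z (nth 0%R (0%R :: ts) i) w = nth 0%N (0%N :: xs) i ->
        Z (nth 0%R ts i) w = nth 0%N xs i.
      move=> ij zi; have := h (Ordinal (leq_ltn_trans ij jm)).
      by rewrite tfE /tf/= zi => /addIr [].
    suff all_i i : (i <= j)%N -> Z (nth 0%R ts i) w = nth 0%N xs i by exact: all_i.
    elim: i => [_|i IH ij]; first by apply: step_nth => //=; exact: Z0.
    by apply: step_nth => //=; apply: IH; exact: ltnW.
rewrite indep; apply: eq_bigr => j _; rewrite levy_kernelE.
have lej := ltf j; have ge0 := nth_ge0 j.
rewrite -(stat (tf (widen_ord (leqnSn m) j))) ?subr_ge0 ?(ltW lej)//.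
by rewrite tfE [in RHS]addrC subrK.
Qed.

(** Read off from the law of the pair at times [t] and [t + h]. The cases [t = 0] and [h = 0] are
    separate because [fdd_levy] needs positive, strictly increasing times. *)
Lemma pgf_levyD (t h : R) s : (0 <= t)%R -> (0 <= h)%R -> (0 <= s <= 1)%R ->
  pgf P (Z (t + h)) s = (pgf P (Z t) s * pgf P (Z h) s)%R.
Proof.
have pgfZ0 : (0 <= s <= 1)%R -> pgf P (Z 0) s = 1%R.
  move=> s01; rewrite /pgf (ae_eq_integral (cst 1))//.
  - by rewrite integral_cst//= mul1e probability_setT.
  - exact: (discrete_rv_measurable_fun (fun k => s ^+ k)%R (mZ (lexx _))).
  - by apply: filterS levy0_ae => w -> _; rewrite expr0.
move=> t0 h0 s01.
have [->|t_neq0] := eqVneq t 0%R; first by rewrite add0r pgfZ0// mul1r.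
have [->|h_neq0] := eqVneq h 0%R; first by rewrite addr0 pgfZ0// mulr1.
have s0 k : (0 <= s ^+ k)%R by case/andP: s01 => *; exact: exprn_ge0.
have mZt := mZ t0; have mZh := mZ h0; have mZth := mZ (addr_ge0 t0 h0).
have joint x y : P [set w | Z t w = x /\ Z (t + h) w = y] =
    P [set w | Z t w = x] * step (fun j => P [set w | Z h w = j]) x y.
  have := @fdd_levy [:: t; (t + h)%R] [:: x; y].
  rewrite /= ltrDl !lt_def t_neq0 h_neq0 t0 h0 => /(_ isT).
  rewrite mule1 /levy_kernel subr0 [(t + h - t)%R]addrC addKr.
  have -> q : step q 0%N x = q x :> \bar R by rewrite /step leq0n subn0.
  move=> <-.
  by congr (P _); apply/seteqP; split=> w /= [-> ->].
apply: EFin_inj; rewrite EFinM !pgf_esum//.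
transitivity (\esum_(y in [set: nat]) \esum_(x in [set: nat]) ((s ^+ y)%:E *
    (P [set w | Z t w = x] * step (fun j => P [set w | Z h w = j]) x y))).
  apply: eq_esum => y _; rewrite esumZ; last 2 first.
  - by rewrite lee_fin.
  - by move=> x; rewrite mule_ge0// step_ge0.
  congr (_ * _); rewrite (prob_total P mZt) => [|]; last exact: mZth.
  by apply: eq_esum => x _; rewrite -joint; congr (P _); apply/seteqP; split=> w /= [].
rewrite esum_exchange; last by move=> y x; rewrite !mule_ge0 ?lee_fin// step_ge0.
rewrite [RHS]muleC -esumZ; last 2 first.
- by apply: esum_ge0 => x _; rewrite mule_ge0// lee_fin.
- by move=> x; rewrite mule_ge0// lee_fin.
apply: eq_esum => x _; rewrite [RHS]muleC -esumZ; last 2 first.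
- by rewrite mule_ge0// lee_fin.
- by move=> y; rewrite mule_ge0// lee_fin.
rewrite -[RHS](esum_shift x); last by move=> y; rewrite !mule_ge0// lee_fin.
apply: eq_esum => y _; rewrite /step; case: leqP => xy; last by rewrite !mule0.
by rewrite muleACA -EFinM -exprD subnKC.
Qed.

Lemma pgf_levyX (t : R) n s : (0 <= t)%R -> (0 <= s <= 1)%R ->
  pgf P (Z (n.+1%:R * t)) s = (pgf P (Z t) s ^+ n.+1)%R.
Proof.
move=> t0 s01; elim: n => [|n IH]; first by rewrite mul1r expr1.
rewrite -natr1 mulrDl mul1r pgf_levyD//; last by rewrite mulr_ge0.
by rewrite IH [RHS]exprSr.
Qed.

(* If [P (Z t = 0) = 0], then [Z t] is a sum of [n] independent copies of
   [Z (t / n) >= 1], hence [Z t >= n], for every [n]. *)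
Lemma pgf_levy_gt0 (t : R) s : (0 <= t)%R -> (0 <= s <= 1)%R -> (0 < pgf P (Z t) s)%R.
Proof.
move=> t0 s01; case/andP: (s01) => s0 s1.
have [->|s_neq0] := eqVneq s 0%R; last first.
  by apply: pgf_gt0; [exact: mZ|rewrite lt_def s_neq0 s0].
have zero01 : (0 <= (0 : R) <= 1)%R by rewrite lexx ler01.
rewrite lt_def pgf_ge0// andbT; apply/negP => /eqP pgf0.
have half01 : (0 <= (2^-1 : R) <= 1)%R by rewrite invr_ge0 ler0n invf_le1 ?ltr0n// ler1n.
have le_half n : (pgf P (Z t) 2^-1 <= 2^-1 ^+ n.+1)%R.
  have tn0 : (0 <= t / n.+1%:R)%R by rewrite divr_ge0.
  have tE : t = (n.+1%:R * (t / n.+1%:R))%R by rewrite mulrC divfK.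
  have : pgf P (Z (t / n.+1%:R)) 0 == 0%R.
    by move/eqP: pgf0; rewrite {1}tE pgf_levyX// expf_eq0.
  rewrite {2}tE pgf_levyX// => /eqP pgfn0; rewrite lerXn2r//; last first.
  - exact: (pgf_le_arg (mZ tn0)).
  - by rewrite nnegrE; case/andP: half01.
  - by rewrite nnegrE pgf_ge0.
have p0 : (0 < pgf P (Z t) 2^-1)%R.
  by apply: pgf_gt0; [exact: mZ|rewrite invr_gt0 ltr0n; case/andP: half01].
have := le_half (Num.truncn (pgf P (Z t) 2^-1)^-1).
apply/negP; rewrite -ltNge exprVn invf_plt ?posrE ?exprn_gt0//.
apply: (lt_le_trans (truncnS_gt _)); rewrite -natrX ler_nat.
exact/ltnW/ltn_expl.
Qed.

(** The function [- ln] of the generating function is additive in [t], and nonnegative because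
    generating functions are at most [1]; it is thus linear in [t]. Strict positivity lets the
    logarithm be inverted, at [s = 0] too. *)
Lemma pgf_levy_powR (t : R) s : (0 <= t)%R -> (0 <= s <= 1)%R ->
  pgf P (Z t) s = (pgf P (Z 1) s `^ t)%R.
Proof.
move=> t0 s01; have gt0 u : (0 <= u)%R -> (0 < pgf P (Z u) s)%R by move=> u0; exact: pgf_levy_gt0.
have lin : (- ln (pgf P (Z t) s) = t * - ln (pgf P (Z 1) s))%R.
  apply: (@additive_nondecreasing_linear R (fun u => - ln (pgf P (Z u) s))%R) => // [u h u0 h0|u u0].
    by rewrite pgf_levyD// lnM ?opprD// posrE gt0.
  by rewrite oppr_ge0 ln_le0// pgf_le1//; exact: mZ.
rewrite mulrN in lin; move/oppr_inj: lin => lin.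
by rewrite /powR gt_eqF ?gt0// -lin lnK// posrE gt0.
Qed.

End Levy.

Lemma mutually_indep_reindex {R : realType} {d : measure_display} {T : measurableType d}
    (P : probability T R) {I J V : Type} (F : I -> T -> V) (g : J -> I) :
  injective g -> mutually_indep P F -> mutually_indep P (fun j => F (g j)).
Proof.
by move=> gI indF n f fI vs; apply: (indF n (fun j => g (f j))); exact: inj_comp.
Qed.

(** Lists of indices without repetition require an equality test on indices; the classical one is
    enough. *)
HB.instance Definition _ := gen_eqMixin ar_idx.

(** * The autoregressive scheme as a homogeneous Markov chain *)

Section Autoregression.
Context {R : realType} {d : measure_display} {T : measurableType d}.
Variables (P : probability T R) (b : R) (X eps : nat -> T -> nat).
Variable Y : nat -> nat -> T -> nat.
Variable eps_law : nat -> \bar R.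
Hypothesis b01 : (0 <= b <= 1)%R.
Hypothesis ar : inar1 P b X eps Y.
Hypothesis epsE : forall n, (1 <= n)%N -> forall k, P [set w | eps n w = k] = eps_law k.
Local Open Scope ereal_scope.

Let F := ar_family (X 0%N) eps Y.
Let S (x : nat) (w : T) : nat := (\sum_(i < x) Y 1%N i w)%N.

Lemma discrete_rv_ar_family i : discrete_rv (F i).
Proof.
case: ar => -[mX0 meps mY] _ _ _.
by case: i => [|n|n j]; [exact: mX0|exact: meps|exact: mY].
Qed.

Lemma indep_ar_family : mutually_indep P F.
Proof. by case: ar. Qed.

Lemma indep_thinning n : mutually_indep P (Y n.+1).
Proof.
have gI : injective (AY n) by move=> i j [].
exact: (mutually_indep_reindex gI indep_ar_family).
Qed.

Lemma thinningE n : (forall i, P [set w | Y n.+1 i w = 1%N] = b%:E) /\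
  (forall i, P [set w | Y n.+1 i w = 0%N] = (1 - b)%:E).
Proof. by case: ar => _ Yb _ _; split=> i; have [] := Yb n.+1 i. Qed.

Lemma discrete_rv_thinning n i : discrete_rv (Y n.+1 i).
Proof. exact: (discrete_rv_ar_family (AY n i)). Qed.

Lemma arS n w : X n.+1 w = (\sum_(i < X n w) Y n.+1 i w + eps n.+1 w)%N.
Proof. by case: ar => _ _ _ ->. Qed.

(** The number of summands in the thinning is random; on each event [X n = x] the next state is a
    function of finitely many primitive variables. *)
Lemma discrete_rv_ar n : discrete_rv (X n).
Proof.
elim: n => [|n IH]; first exact: (discrete_rv_ar_family AX0).
move=> k; rewrite (_ : [set w | X n.+1 w = k] = \bigcup_(x in [set: nat])
  ([set w | X n w = x] `&` [set w | (fun v => sumn v = k)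
    [seq F i w | i <- AEps n :: [seq AY n i | i <- iota 0 x]]])).
  apply: bigcup_measurable => x _; apply: measurableI; first exact: IH.
  have mblock : discrete_rv (fun w => [seq F i w | i <- AEps n :: [seq AY n i | i <- iota 0 x]]).
    by apply: discrete_rv_map => i _; exact: discrete_rv_ar_family.
  exact: (discrete_rv_event [set v | sumn v = k] mblock).
apply/seteqP; split=> [w /= <-|w [x _ [/= Xn <-]]].
  exists (X n w) => //=; split=> //; rewrite arS addnC -map_comp; congr (_ + _)%N.
  by rewrite (thinned_sumn (Y n.+1)).
rewrite arS Xn addnC -map_comp; congr (_ + _)%N.
by rewrite (thinned_sumn (Y n.+1)).
Qed.

Definition ar_kernel (x k : nat) : \bar R :=
  P [set w | (S x w + eps 1 w = k)%N].

(** The primitive variables that produce [X n.+1] when [X n] equals [x]. *)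
Definition ar_block (n x : nat) := AEps n :: [seq AY n i | i <- iota 0 x].

Lemma sumn_ar_block n x w : sumn [seq F i w | i <- ar_block n x] =
  (\sum_(i < x) Y n.+1 i w + eps n.+1 w)%N.
Proof. by rewrite (thinned_sumn (Y n.+1)) /= -map_comp addnC. Qed.

Lemma ar_block_uniq n x : uniq (ar_block n x).
Proof.
rewrite /= map_inj_uniq ?iota_uniq ?andbT; last by move=> i j [].
by apply/mapP => -[].
Qed.

Lemma bernoulli_law n i v :
  P [set w | Y n.+1 i w = v] = P [set w | Y 1%N 0%N w = v].
Proof.
have [Y1 Y0] := thinningE n; have [Y1' Y0'] := thinningE 0.
have [v2|] := ltnP 1 v; last by case: v => [|[|]]// _; rewrite ?Y0 ?Y1 ?Y0' ?Y1'.
have null m j : P [set w | Y m.+1 j w = v] = 0.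
  have [Z1 Z0] := thinningE m.
  rewrite -(measure0 P) (@prob_ae_eq _ _ _ P _ set0)//.
    exact: (discrete_rv_thinning m j v).
  apply: filterS (bernoulli_ae (discrete_rv_thinning m) Z1 Z0 j) => w Yw; split=> //= Yk.
  by move: v2; rewrite -Yk ltnNge Yw.
by rewrite !null.
Qed.

(** Homogeneity in time: the variables of step [n.+1] have the same laws as those of step [1]. The
    classes [c] forget the step number and remember only the role of a variable. *)
Lemma ar_block_law n x k :
  P [set w | sumn [seq F i w | i <- ar_block n x] = k] = ar_kernel x k.
Proof.
rewrite /ar_kernel.
rewrite [RHS](_ : _ = P [set w | (fun v => sumn v = k) [seq F i w | i <- ar_block 0 x]]); last first.
  by congr (P _); apply/seteqP; split=> w; rewrite /mkset sumn_ar_block.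
pose c i : bool + unit := match i with AX0 => inr tt | AEps _ => inl true | AY _ _ => inl false end.
pose law (e : bool + unit) v := match e with
  | inr _ => P [set w | X 0%N w = v] | inl true => eps_law v
  | inl false => P [set w | Y 1%N 0%N w = v] end.
apply: (@indep_seq_law R d T P _ _ F indep_ar_family discrete_rv_ar_family _ c law
  _ _ (fun v => sumn v = k)).
- by case=> [|m|m j] v //=; [exact: epsE|exact: bernoulli_law].
- exact: ar_block_uniq.
- exact: ar_block_uniq.
by rewrite /= -!map_comp.
Qed.

(** Prescribing the whole path removes the random number of summands: each step then constrains a
    deterministic block of primitive variables. *)
Fixpoint ar_blocks (n x : nat) (xs : seq nat) : seq (seq ar_idx * set (seq nat)) :=
  if xs is k :: xs' then
    (ar_block n x, [set v | sumn v = k]) :: ar_blocks n.+1 k xs'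
  else [::].

Lemma ar_blocks_event n x xs w : X n w = x ->
  block_event F (ar_blocks n x xs) w <-> [seq X m w | m <- iota n.+1 (size xs)] = xs.
Proof.
elim: xs n x => [|k xs IH] n x Xn //=.
rewrite -[(eps n.+1 w + _)%N]/(sumn [seq F i w | i <- ar_block n x]) sumn_ar_block -Xn -arS.
split=> [[Xk]|[Xk]]; first by move=> /(IH _ _ Xk) ->; rewrite Xk.
by move=> /(IH _ _ Xk) h; split.
Qed.

Lemma ar_blocks_uniq n x xs : uniq (AX0 :: flatten [seq e.1 | e <- ar_blocks n x xs]).
Proof.
(* [idx] is the step at which a variable is used, [0] being kept for the initial state; later blocks
   contain only larger values and are therefore disjoint from earlier ones. *)
pose idx i := match i with AX0 => 0%N | AEps m => m.+1 | AY m _ => m.+1 end.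
have idx_gt m y ys : all (fun i => (m < idx i)%N) (flatten [seq e.1 | e <- ar_blocks m y ys]).
  elim: ys m y => //= k ys IH m y; rewrite ltnSn all_cat all_map.
  rewrite andTb; apply/andP; split; first by apply/allP => j _ /=.
  by apply: sub_all (IH m.+1 k) => i; exact: ltnW.
rewrite cons_uniq; apply/andP; split.
  by apply/negP => /(allP (idx_gt n x xs)).
elim: xs n x => // k xs IH n x.
have -> : flatten [seq e.1 | e <- ar_blocks n x (k :: xs)] =
  ar_block n x ++ flatten [seq e.1 | e <- ar_blocks n.+1 k xs] by [].
rewrite cat_uniq ar_block_uniq IH andbT; apply/hasPn => i /(allP (idx_gt n.+1 k xs)) ni.
apply/negP; rewrite in_cons => /orP[/eqP ein|/mapP[j _ ein]]; by rewrite ein /= ltnn in ni.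
Qed.

(** The kernel is homogeneous, so the times are trivial and serve only to fix the length. *)
Definition ar_chain x xs := chain (fun=> fun y => fun=> ar_kernel y) tt x (nseq (size xs) tt) xs.

(** The Markov property in product form: the blocks of distinct steps are disjoint, hence
    independent, and each contributes one factor [ar_kernel]. *)
Lemma ar_path_law x xs :
  P [set w | X 0%N w = x /\ [seq X m w | m <- iota 1 (size xs)] = xs] =
  P [set w | X 0%N w = x] * ar_chain x xs.
Proof.
transitivity (P [set w | block_event F
    (([:: AX0], [set v | v = [:: x]]) :: ar_blocks 0 x xs) w]).
  congr (P _); apply/seteqP; split=> w /=.
    by move=> [Xx /(ar_blocks_event _ Xx) h]; rewrite Xx.
  by move=> [[Xx] h]; split=> //; apply/(ar_blocks_event _ Xx).
rewrite (indep_blocks indep_ar_family discrete_rv_ar_family); last exact: ar_blocks_uniq.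
rewrite big_cons /=; congr (_ * _).
  by congr (P _); apply/seteqP; split=> w /= => [[]|->].
rewrite /ar_chain; elim: xs 0%N x => [|k xs IH] n x; first by rewrite big_nil.
by rewrite /= big_cons IH; congr (_ * _); exact: ar_block_law.
Qed.

Lemma ar_kernel_ge0 x k : 0 <= ar_kernel x k. Proof. by []. Qed.

Lemma ar_law1 k : P [set w | X 1%N w = k] =
  \esum_(x in [set: nat]) (P [set w | X 0%N w = x] * ar_kernel x k).
Proof.
rewrite (prob_total P (discrete_rv_ar 0)); last exact: discrete_rv_ar.
apply: eq_esum => x _; have := ar_path_law x [:: k].
rewrite /ar_chain /= mule1 => <-.
by congr (P _); apply/seteqP; split=> w /= => [[-> ->]|[-> []]].
Qed.

(** Path laws are determined by the initial law and a kernel common to all steps, so equality in law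
    of [X 1] and [X 0] propagates to paths of any length. *)
Lemma ar_stationary : (forall k, P [set w | X 1%N w = k] = P [set w | X 0%N w = k]) ->
  stationary_seq P X.
Proof.
move=> X10.
have mpath n N : discrete_rv (fun w => [seq X m w | m <- iota n N]).
  by apply: discrete_rv_map => m _; exact: discrete_rv_ar.
have path_law N v : P [set w | [seq X m w | m <- iota 1 N.+1] = v] =
    P [set w | [seq X m w | m <- iota 0 N.+1] = v].
  have [sv|sv] := eqVneq N.+1 (size v); last first.
    rewrite [X in P X = _](_ : _ = set0) ?[X in _ = P X](_ : _ = set0)//.
      by apply/seteqP; split=> // w /= e; move: sv; rewrite -e /= size_map size_iota eqxx.
    by apply/seteqP; split=> // w /= e; move: sv; rewrite -e /= size_map size_iota eqxx.
  case: v sv => // x xs [sxs].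
  transitivity (P [set w | X 0%N w = x] * ar_chain x xs); last first.
    by rewrite -ar_path_law sxs; congr (P _); apply/seteqP; split=> w /= => [[-> ->]|[-> ->]].
  rewrite -X10 ar_law1 muleC -esumZ; last 2 first.
  - by apply: chain_ge0 => *; exact: ar_kernel_ge0.
  - by move=> y; apply: mule_ge0 => //; exact: ar_kernel_ge0.
  rewrite (prob_total P (discrete_rv_ar 0)); last exact: mpath.
  apply: eq_esum => y _; rewrite muleC -muleA.
  have := ar_path_law y (x :: xs); rewrite /ar_chain /= -/(ar_chain x xs) => <-.
  by congr (P _); rewrite sxs; apply/seteqP; split=> w /= => [[-> ->]|[-> ->]].
have shift1 ns ks : fdd P (fun n => X (n + 1)%N) ns ks = fdd P X ns ks.
  (* The indices in [ns] may be unordered and repeated; their values are selected from the full path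
     up to the largest index. *)
  pose N := (\max_(n <- ns) n)%N; pose A v := [seq nth 0%N v n | n <- ns] = ks.
  have nthE m w n : n \in ns -> nth 0%N [seq X i w | i <- iota m N.+1] n = X (m + n)%N w.
    move=> nns; have nN : (n < N.+1)%N by rewrite ltnS; exact: leq_bigmax_seq.
    by rewrite (nth_map 0%N) ?size_iota// nth_iota.
  rewrite /fdd.
  transitivity (P [set w | A [seq X i w | i <- iota 1 N.+1]]).
    congr (P _); apply/seteqP; split=> w; rewrite /A /= => <-.
      by apply/eq_in_map => n nns; rewrite nthE// addnC.
    by apply/eq_in_map => n nns; rewrite nthE// addnC.
  transitivity (P [set w | A [seq X i w | i <- iota 0 N.+1]]).
    by rewrite !(prob_event P A (mpath _ _)); apply: eq_esum => v _.
  congr (P _); apply/seteqP; split=> w; rewrite /A /= => <-.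
    by apply/eq_in_map => n nns; rewrite nthE.
  by apply/eq_in_map => n nns; rewrite nthE.
elim=> [|m IH] ns ks.
  by congr (fdd _ _ _ _); apply/funext => n; rewrite addn0.
rewrite -IH; have := shift1 [seq (n + m)%N | n <- ns] ks.
rewrite /fdd => h.
transitivity (P [set w | [seq X (n + 1)%N w | n <- [seq (n + m)%N | n <- ns]] = ks]).
  congr (P _); apply/seteqP; split=> w /= <-; rewrite -map_comp;
    by apply: eq_map => n /=; rewrite -addnA addn1.
by rewrite h; congr (P _); apply/seteqP; split=> w /= <-; rewrite -map_comp.
Qed.

Lemma indep_thinned_eps x a k : P [set w | S x w = a /\ eps 1%N w = k] =
  P [set w | S x w = a] * P [set w | eps 1%N w = k].
Proof.
pose A1 v := sumn v = a; pose A2 v := v = [:: k].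
have A1E w : A1 [seq F i w | i <- [seq AY 0 i | i <- iota 0 x]] = (S x w = a).
  by rewrite /A1 /S (thinned_sumn (Y 1%N)) -map_comp.
have A2E w : A2 [seq F i w | i <- [:: AEps 0]] = (eps 1%N w = k).
  by rewrite /A2 /=; apply/propext; split=> [[]|->].
rewrite (_ : [set w | S x w = a /\ _] = [set w | A1 [seq F i w | i <- [seq AY 0 i | i <- iota 0 x]] /\
  A2 [seq F i w | i <- [:: AEps 0]]]); last by apply/seteqP; split=> w /=; rewrite A1E A2E.
rewrite (indep_seq_cat indep_ar_family discrete_rv_ar_family A1 A2); last first.
  rewrite cat_uniq map_inj_uniq ?iota_uniq; last by move=> i j [].
  by rewrite /= orbF andbT; apply/mapP => -[].
by congr (P _ * P _); apply/seteqP; split=> w /=; rewrite ?A1E ?A2E.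
Qed.

(** From state [x], the survivors are a sum of [x] Bernoulli variables independent of the
    innovation, which gives [(1 - b + b * s) ^+ x] times the generating function of [eps 1].
    Averaging over [x] evaluates that of [X 0] at [1 - b + b * s]. *)
Lemma pgf_ar1 (s : R) : (0 <= s <= 1)%R ->
  pgf P (X 1%N) s = (pgf P (X 0%N) (1 - b + b * s) * pgf P (eps 1%N) s)%R.
Proof.
move=> s01; have [Y1 Y0] := thinningE 0; have mY := discrete_rv_thinning 0.
have meps : discrete_rv (eps 1%N) by exact: (discrete_rv_ar_family (AEps 0)).
have mS x : discrete_rv (S x) by exact: discrete_rv_thinned.
have s0 k : (0 <= s ^+ k)%R by case/andP: s01 => *; exact: exprn_ge0.
have u01 : (0 <= 1 - b + b * s <= 1)%R.
  by case/andP: s01 b01 => s0' s1 /andP[b0 b1]; apply/andP; split; nra.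
have u0 k : (0 <= (1 - b + b * s) ^+ k)%R by case/andP: u01 => *; exact: exprn_ge0.
have kernel_pgf x : \esum_(k in [set: nat]) ((s ^+ k)%:E * ar_kernel x k) =
    ((1 - b + b * s) ^+ x)%:E * (pgf P (eps 1%N) s)%:E.
  rewrite -EFinM -(pgf_thinned mY (indep_thinning 0) Y1 Y0)// -pgfD//;
    [|exact: mS|exact: indep_thinned_eps].
  rewrite pgf_esum//.
  exact: (discrete_rv_comp (fun c => c.1 + c.2)%N (discrete_rv_pair (mS x) meps)).
apply: EFin_inj; rewrite pgf_esum//; last exact: discrete_rv_ar.
under eq_esum => k _.
  rewrite ar_law1 -esumZ; last 2 first.
  - by rewrite lee_fin.
  - by move=> x; rewrite mule_ge0// ar_kernel_ge0.
  over.
rewrite esum_exchange; last by move=> k x; rewrite !mule_ge0 ?lee_fin// ar_kernel_ge0.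
rewrite EFinM pgf_esum//; last exact: discrete_rv_ar.
rewrite [RHS]muleC -esumZ; last 2 first.
- by rewrite lee_fin; apply: pgf_ge0.
- by move=> x; rewrite mule_ge0// lee_fin.
apply: eq_esum => x _; rewrite muleA [(pgf _ _ _)%:E * _]muleC -kernel_pgf muleC -esumZ//.
- by apply: eq_esum => k _; rewrite muleCA.
- by move=> k; rewrite mule_ge0 ?lee_fin// ar_kernel_ge0.
Qed.

End Autoregression.

(** * Thinning a Lévy process *)

Section ThinnedLevy.
Context {R : realType} {d : measure_display} {T : measurableType d}.
Context {dZ : measure_display} {TZ : measurableType dZ}.
Variables (P : probability T R) (b : R) (Y : nat -> T -> nat).
Hypothesis mY : forall i, discrete_rv (Y i).
Hypothesis indepY : mutually_indep P Y.
Hypothesis Y1 : forall i, P [set w | Y i w = 1%N] = b%:E.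
Hypothesis Y0 : forall i, P [set w | Y i w = 0%N] = (1 - b)%:E.
Hypothesis b01 : (0 <= b <= 1)%R.
Variables (PZ : probability TZ R) (Z : R -> TZ -> nat).
Hypothesis levyZ : levy_process PZ Z.
Local Open Scope ereal_scope.

Let S (x : nat) (w : T) : nat := (\sum_(i < x) Y i w)%N.

Let mZ t : (0 <= t)%R -> discrete_rv (Z t).
Proof. by case: levyZ => + _ _ _; exact. Qed.

Let mZs (ts : seq R) : all (fun t => 0 <= t)%R ts ->
  discrete_rv (fun w => [seq Z t w | t <- ts]).
Proof. by move=> /allP ts0; apply: discrete_rv_map => t /ts0; exact: mZ. Qed.

Lemma thin_prob_ge0 xs ks : (0 <= thin_prob b xs ks)%R.
Proof. by rewrite -lee_fin (thin_probE mY indepY Y1 Y0). Qed.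

(** The two factors live on different probability spaces; the sum over the paths of [Z] takes the
    place of a joint construction. *)
Lemma thin_fdd_esum ts ks : all (fun t => 0 <= t)%R ts ->
  thin_fdd PZ b Z ts ks =
  \esum_(xs in [set: seq nat]) (fdd PZ Z ts xs * fdd P S xs ks).
Proof.
move=> ts0; rewrite /thin_fdd.
rewrite (expectation_esum PZ (f := fun xs => thin_prob b xs ks) (mZs ts0)); last first.
  by move=> xs; exact: thin_prob_ge0.
by apply: eq_esum => xs _; rewrite (thin_probE mY indepY Y1 Y0) muleC.
Qed.

Definition thinned_law (t : R) (k : nat) : \bar R :=
  \esum_(x in [set: nat]) (PZ [set w | Z t w = x] * P [set w | S x w = k]).

(** Given the path of [Z], the thinned values are a walk whose times are the states of [Z];
    composing the two chains shows that the thinned process again has stationary independent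
    increments. *)
Lemma thin_fdd_levy ts ks : path <%R 0%R ts ->
  thin_fdd PZ b Z ts ks =
  chain (fun t0 k0 t k => step (thinned_law (t - t0)) k0 k) 0%R 0%N ts ks.
Proof.
move=> pts; have ts0 : all (fun t => 0 <= t)%R ts.
  by apply/allP => t /(allP (order_path_min lt_trans pts)); exact: ltW.
rewrite thin_fdd_esum// -(@chain_comp R _ _ _ (levy_kernel PZ Z) (thin_kernel P Y) _ _ 0%N).
- apply: eq_esum => xs _; rewrite (fdd_levy levyZ)//.
  (* The product formula for the thinned walk needs a nondecreasing path; any other path has weight
     [0] under the Lévy kernel. *)
  have [pxs|pxs] := boolP (path leq 0%N xs).
    by rewrite (fdd_thinned mY indepY Y1 Y0).
  suff -> : chain (levy_kernel PZ Z) 0%R 0%N ts xs = 0 by rewrite !mul0e.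
  elim: ts xs 0%R 0%N pxs {pts ts0} => [|t ts IH] [|x xs]//= t0 x0.
  rewrite negb_and => /orP[|/IH ->]; last by rewrite mule0.
  by rewrite /levy_kernel /step => /negbTE ->; rewrite mul0e.
- by move=> t x t' x'; apply: step_ge0.
- by move=> t x t' x'; apply: step_ge0.
- move=> t x t' j j'; rewrite /levy_kernel /thin_kernel.
  exact: (step_comp (q := fun n k => P [set w | S n w = k])).
Qed.

Lemma thin_fdd1 t k : (0 < t)%R -> thin_fdd PZ b Z [:: t] [:: k] = thinned_law t k.
Proof.
move=> t0; rewrite thin_fdd_levy /= ?t0// mule1 subr0.
by rewrite /step leq0n subn0.
Qed.

Lemma esum_thinned_law t (s : R) : (0 <= t)%R -> (0 <= s <= 1)%R ->
  \esum_(k in [set: nat]) ((s ^+ k)%:E * thinned_law t k) =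
  (pgf PZ (Z t) (1 - b + b * s))%:E.
Proof.
move=> t0 s01; have mS x : discrete_rv (S x) by exact: discrete_rv_thinned.
have s0 k : (0 <= s ^+ k)%R by case/andP: s01 => *; exact: exprn_ge0.
have u01 : (0 <= 1 - b + b * s <= 1)%R.
  by case/andP: s01 b01 => s0' s1 /andP[b0 b1]; apply/andP; split; nra.
rewrite pgf_esum//; last exact: mZ.
under eq_esum => k _.
  rewrite -esumZ; [|by rewrite lee_fin|by move=> x; rewrite mule_ge0].
  over.
rewrite esum_exchange; last by move=> k x; rewrite !mule_ge0 ?lee_fin.
apply: eq_esum => x _; rewrite -(pgf_thinned mY indepY Y1 Y0)// pgf_esum//; last exact: mS.
rewrite muleC -esumZ//.
- by apply: eq_esum => k _; rewrite muleCA.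
- by move=> k; rewrite mule_ge0 ?lee_fin.
Qed.

Lemma thinned_law_ge0 t k : 0 <= thinned_law t k.
Proof. by apply: esum_ge0 => x _; rewrite mule_ge0. Qed.

Lemma thinned_law_sum1 t : (0 <= t)%R -> \esum_(k in [set: nat]) thinned_law t k = 1.
Proof.
have one01 : (0 <= (1 : R) <= 1)%R by rewrite ler01 lexx.
move=> t0; transitivity (pgf PZ (Z t) 1)%:E.
  have <- : (1 - b + b * 1 = 1)%R by rewrite mulr1 subrK.
  by rewrite -esum_thinned_law//; apply: eq_esum => k _; rewrite expr1n mul1e.
rewrite pgf_esum//; last exact: mZ.
by rewrite -(law_sum1 PZ (mZ t0)); apply: eq_esum => k _; rewrite expr1n mul1e.
Qed.

(** Since [thinned_law] is a mixture and not given as the law of a variable, uniqueness goes through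
    its coefficients, whose total mass is [1]. The variable [V] may live on any space: this serves
    both the innovations and [Z] itself. *)
Lemma pgf_thinned_law {dV : measure_display} {TV : measurableType dV}
    (PV : probability TV R) (V : TV -> nat) t :
  discrete_rv V -> (0 <= t)%R ->
  (forall k, PV [set w | V w = k] = thinned_law t k) <->
  (forall s, 0 <= s <= 1 -> pgf PV V s = pgf PZ (Z t) (1 - b + b * s))%R.
Proof.
move=> mV t0; split=> [VE s s01|VE k].
  apply: EFin_inj; rewrite -esum_thinned_law// pgf_esum//.
  by apply: eq_esum => k _; rewrite VE.
have fV j : PV [set w | V w = j] = (fine (PV [set w | V w = j]))%:E.
  by rewrite fineK// fin_num_measure.
have fL j : thinned_law t j = (fine (thinned_law t j))%:E.
  rewrite fineK// ge0_fin_numE ?thinned_law_ge0//.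
  apply: (@le_lt_trans _ _ 1); last exact: ltry.
  rewrite -(thinned_law_sum1 t0); apply: esum_ge; exists [set j]; last by rewrite fsbig_set1.
  by split.
rewrite fV fL; congr (_%:E).
apply: (@pgf_coef_inj _ (fun j => fine (PV [set w | V w = j]))
  (fun j => fine (thinned_law t j))).
- by move=> j; exact: fine_ge0.
- by move=> j; apply: fine_ge0; exact: thinned_law_ge0.
- by under eq_esum => j _ do rewrite -fV; rewrite law_sum1.
- by under eq_esum => j _ do rewrite -fL; rewrite thinned_law_sum1.
move=> s s01; have s01' : (0 <= s <= 1)%R by case/andP: s01 => /ltW -> /ltW ->.
transitivity (pgf PV V s)%:E.
  by rewrite pgf_esum//; apply: eq_esum => j _; rewrite EFinM -fV.
by rewrite VE// -esum_thinned_law//; apply: eq_esum => j _; rewrite EFinM -fL.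
Qed.

(* Finite-dimensional laws at arbitrary times are images of the laws at
   increasing positive times: sort the positive times, and use [Z 0 = 0]. *)
Lemma semi_selfsimilar_of_law (a H : R) : (0 < a < 1)%R -> (0 < H)%R ->
  (a `^ H = b)%R ->
  (forall t k, (0 < t)%R -> PZ [set w | Z (a * t) w = k] = thinned_law t k) ->
  semi_selfsimilar PZ a H Z.
Proof.
move=> a01 H0 aH law; split=> // ts ks /allP ts0; rewrite aH.
case/andP: (a01) => a0 _.
have at0 t : (0 <= t)%R -> (0 <= a * t)%R by move=> ?; rewrite mulr_ge0// ltW.
pose us := sort <=%R (undup [seq t <- ts | t != 0%R]).
have us_gt0 t : t \in us -> (0 < t)%R.
  by rewrite mem_sort mem_undup mem_filter => /andP[tn0 /ts0]; rewrite lt_def tn0.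
have us0 : all (fun t => 0 <= t)%R us by apply/allP => t /us_gt0 /ltW.
have pus : path <%R 0%R us.
  rewrite path_min_sorted; last by apply/allP.
  by rewrite lt_sorted_uniq_le sort_uniq undup_uniq sort_sorted//; exact: le_total.
pose phi v := [seq if t == 0%R then 0%N else nth 0%N v (index t us) | t <- ts].
have phiE (f : R -> nat) : f 0%R = 0%N -> [seq f t | t <- ts] = phi [seq f t | t <- us].
  move=> f0; apply/eq_in_map => t tts; case: eqVneq => [->//|tn0].
  have tus : t \in us by rewrite mem_sort mem_undup mem_filter tn0.
  by rewrite (nth_map 0%R) ?index_mem// nth_index.
pose A v := phi v = ks.
have S0 w : S 0 w = 0%N by rewrite /S big_ord0.
have fdd_us v : fdd PZ (fun t => Z (a * t)) us v = thin_fdd PZ b Z us v.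
  transitivity (fdd PZ Z [seq a * t | t <- us]%R v).
    by congr (PZ _); apply/seteqP; split=> w /= <-; rewrite -map_comp.
  rewrite (fdd_levy levyZ); last first.
    by rewrite -[0%R](mulr0 a) path_map; under eq_path => x y do rewrite /= ltr_pM2l//.
  rewrite thin_fdd_levy//.
  (* The starting time [0] is written [a * 0], so that the induction can generalize it to [a * t0];
     the increments of the scaled times are then [a * (t - t0)]. *)
  rewrite -[X in chain _ X](mulr0 a).
  elim: us 0%R 0%N v pus {us0 us_gt0 phi phiE A} => [|t us' IH] t0 x0 [|x xs]//= /andP[t0t pus].
  rewrite IH//; congr (_ * _); rewrite /levy_kernel -mulrBr /step; case: ifP => // _.
  by rewrite law// subr_gt0.
have mZa : discrete_rv (fun w => [seq Z (a * t) w | t <- us]%R).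
  by apply: discrete_rv_map => t /us_gt0 /ltW /at0; exact: mZ.
transitivity (\esum_(v in A) fdd PZ (fun t => Z (a * t)) us v).
  rewrite -(prob_event PZ A mZa); apply: prob_ae_eq.
  - by apply: discrete_rv_map => t /ts0 /at0; exact: mZ.
  - exact: (discrete_rv_event A mZa).
  - apply: filterS (levy0_ae levyZ) => w Z0w.
    by rewrite /mkset /A (phiE (fun t => Z (a * t) w))// mulr0.
transitivity (\esum_(v in A) \esum_(xs in [set: seq nat]) (fdd PZ Z us xs * fdd P S xs v)).
  by apply: eq_esum => v _; rewrite fdd_us thin_fdd_esum.
rewrite esum_exchange; last by move=> v xs; rewrite mule_ge0.
(* Thinning commutes with [phi], which only copies entries and inserts zeros, because [S 0 = 0]; the
   default value [0] of [nth] is harmless for the same reason. *)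
have thin_phi xs : fdd P S (phi xs) ks = \esum_(v in A) fdd P S xs v.
  rewrite -(prob_event P A (U := fun w => [seq S x w | x <- xs])); last first.
    by apply: discrete_rv_map => x _; exact: discrete_rv_thinned.
  have nthS w i : nth 0%N [seq S x w | x <- xs] i = S (nth 0%N xs i) w.
    have [ixs|ixs] := ltnP i (size xs); first by rewrite (nth_map 0%N).
    by rewrite !nth_default ?size_map.
  congr (P _); apply/seteqP; rewrite /A; split=> w /= <-;
    by rewrite /phi -map_comp; apply: eq_map => t /=; case: ifP => // _; rewrite nthS.
rewrite (_ : thin_fdd _ _ _ _ _ = \int[PZ]_w (thin_prob b (phi [seq Z t w | t <- us]) ks)%:E); last first.
  apply: ae_eq_integral => //.
  - apply: (discrete_rv_measurable_fun (fun xs => thin_prob b xs ks)).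
    by apply: mZs; apply/allP.
  - exact: (discrete_rv_measurable_fun (fun xs => thin_prob b (phi xs) ks) (mZs us0)).
  - apply: filterS (levy0_ae levyZ) => w Z0w _.
    by rewrite -(phiE (fun t => Z t w)).
rewrite (expectation_esum PZ (f := fun xs => thin_prob b (phi xs) ks) (mZs us0)); last first.
  by move=> xs; exact: thin_prob_ge0.
apply: eq_esum => xs _; rewrite (thin_probE mY indepY Y1 Y0) -/(fdd P S (phi xs) ks).
by rewrite thin_phi muleC esumZ.
Qed.

End ThinnedLevy.

(** * Both implications, reduced to one identity between generating functions *)

Theorem theorem2p4 (R : realType) (b alpha : R)
  (dZ : measure_display) (TZ : measurableType dZ) (PZ : probability TZ R)
  (Z : R -> TZ -> nat)
  (d : measure_display) (T : measurableType d) (P : probability T R)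
  (X eps : nat -> T -> nat) (Y : nat -> nat -> T -> nat) :
  0 < b < 1 -> 0 < alpha <= 1 ->
  levy_process PZ Z ->
  inar1 P b X eps Y ->
  (* X_0 =d Z(1) *)
  (forall k : nat, P [set w | X 0%N w = k] = PZ [set w | Z 1 w = k]) ->
  (* eps_n =d b (x) Z(b^-alpha - 1), n >= 1 *)
  (forall n : nat, (1 <= n)%N -> forall k : nat,
     P [set w | eps n w = k] = thin_fdd PZ b Z [:: b `^ (- alpha) - 1] [:: k]) ->
  (semi_selfsimilar PZ (b `^ alpha) alpha^-1 Z ->
     stationary_seq P X /\
     forall n, disc_semistable P (b `^ alpha) b (X n)) /\
  (stationary_seq P X ->
     (forall n, disc_semistable P (b `^ alpha) b (X n)) /\
     semi_selfsimilar PZ (b `^ alpha) alpha^-1 Z).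
Proof.
move=> b01 alpha01 levyZ ar X0E epsE; case/andP: (b01) => b0 b1; case/andP: alpha01 => al0 al1.
have b01' : 0 <= b <= 1 by rewrite !ltW.
have mZ t : 0 <= t -> discrete_rv (Z t) by case: levyZ => + _ _ _; exact.
have [Y1 Y0] := thinningE ar 0.
have mY := discrete_rv_thinning ar 0; have indepY : mutually_indep P (Y 1%N) by exact: (indep_thinning ar).
have meps : discrete_rv (eps 1%N) by exact: (discrete_rv_ar_family ar (AEps 0)).
have mX n : discrete_rv (X n) by exact: (discrete_rv_ar ar).
set a := b `^ alpha.
have a0 : 0 < a by exact: powR_gt0.
have a1 : a < 1.
  have -> : 1 = 1 `^ alpha by rewrite powR1.
  by apply: gt0_ltr_powR; rewrite ?nnegrE ?(ltW b0).
have aV : a `^ alpha^-1 = b by rewrite -powRrM mulfV ?gt_eqF// powRr1// ltW.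
have tauE : b `^ (- alpha) = a^-1 by rewrite powRN.
have tau0 : 0 < b `^ (- alpha) - 1 by rewrite tauE subr_gt0 invf_gt1.
pose u s := 1 - b + b * s.
have u01 s : 0 <= s <= 1 -> 0 <= u s <= 1.
  by move=> /andP[s0 s1]; apply/andP; split; rewrite /u; nra.
pose G s := pgf PZ (Z 1) s.
have G0 s : 0 <= s <= 1 -> 0 < G s by move=> s01; exact: (pgf_levy_gt0 levyZ).
have pgfX0 s : 0 <= s <= 1 -> pgf P (X 0%N) s = G s.
  move=> s01; apply: EFin_inj; rewrite !pgf_esum//; last exact: mZ.
  by apply: eq_esum => k _; rewrite X0E.
have pgfeps s : 0 <= s <= 1 -> pgf P (eps 1%N) s = G (u s) `^ (a^-1 - 1).
  move=> s01; rewrite -tauE -(pgf_levy_powR levyZ) ?(ltW tau0) ?u01//.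
  apply: (pgf_thinned_law mY indepY Y1 Y0 b01' levyZ P meps (ltW tau0)).1 => // k.
  by rewrite epsE// (thin_fdd1 mY indepY Y1 Y0 levyZ).
pose eps_law k := thin_fdd PZ b Z [:: b `^ (- alpha) - 1] [:: k].
have eps_lawE n : (1 <= n)%N -> forall k, P [set w | eps n w = k] = eps_law k.
  exact: epsE.
(* The survivors contribute exponent [1] and the innovation [a^-1 - 1]; the innovation time is
   chosen so that these add up to [a^-1]. *)
have pgfX1 s : 0 <= s <= 1 -> pgf P (X 1%N) s = G (u s) `^ a^-1.
  move=> s01; rewrite (pgf_ar1 b01' ar eps_lawE)// pgfX0 ?u01// pgfeps//.
  by rewrite mulr_powRB1 ?invr_gt0// ltW// G0// u01.
have stationary_law n k : stationary_seq P X ->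
    P [set w | X n w = k] = P [set w | X 0%N w = k].
  move=> /(_ n [:: 0%N] [:: k]); rewrite /fdd /= add0n => st.
  rewrite (_ : [set w | X n w = k] = [set w | [:: X n w] = [:: k]]); last first.
    by apply/seteqP; split=> w /= => [->|[]].
  by rewrite st; congr (P _); apply/seteqP; split=> w /= => [[]|->].
have semistable : stationary_seq P X ->
    (forall s, 0 <= s <= 1 -> G s `^ a = G (u s)) ->
    forall n, disc_semistable P a b (X n).
  move=> st Ga n; split; rewrite ?a0 ?b0//.
    by exists alpha; rewrite al0 al1 aV.
  move=> s s01; have pgfXn v : 0 <= v <= 1 -> pgf P (X n) v = G v.
    move=> v01; rewrite -pgfX0//; apply: EFin_inj; rewrite !pgf_esum//.
    by apply: eq_esum => k _; rewrite stationary_law.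
  by rewrite !pgfXn ?u01// gt_eqF ?G0// Ga.
split=> [[_ _ ssZ]|st].
  have Ga s : 0 <= s <= 1 -> G s `^ a = G (u s).
    move=> s01; rewrite -(pgf_levy_powR levyZ)//; last exact: ltW.
    apply: (pgf_thinned_law mY indepY Y1 Y0 b01' levyZ PZ (mZ _ (ltW a0)) ler01).1 => // k.
    have := ssZ [:: 1] [:: k]; rewrite /= ler01 => /(_ isT).
    rewrite aV (thin_fdd1 mY indepY Y1 Y0 levyZ)// /fdd /= mulr1 => <-.
    by congr (PZ _); apply/seteqP; split=> w /= => [->|[]].
  have st : stationary_seq P X.
    apply: (ar_stationary ar eps_lawE).
    apply: pgf_inj => // s s01; have s01' : 0 <= s <= 1.
      by case/andP: s01 => /ltW -> /ltW ->.
    rewrite pgfX1// pgfX0// -Ga// -powRrM mulfV ?gt_eqF// powRr1//.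
    by rewrite ltW// G0.
  by split=> //; exact: semistable.
have Ga s : 0 <= s <= 1 -> G s `^ a = G (u s).
  move=> s01; have -> : G s = pgf P (X 1%N) s.
    rewrite -pgfX0//; apply: EFin_inj; rewrite !pgf_esum//.
    by apply: eq_esum => k _; rewrite (stationary_law 1%N).
  rewrite pgfX1// -powRrM mulVf ?gt_eqF// powRr1//.
  by rewrite ltW// G0// u01.
split; first exact: semistable.
apply: (semi_selfsimilar_of_law mY indepY Y1 Y0 levyZ); rewrite ?a0 ?invr_gt0//.
move=> t k t0; have at0 : 0 <= a * t by rewrite mulr_ge0// ltW.
move: k; apply: (pgf_thinned_law mY indepY Y1 Y0 b01' levyZ PZ (mZ _ at0) (ltW t0)).2 => s s01.
(* The exponent [a * t] is applied as [a] and then [t], so the identity [Ga] at time [1] passes to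
   every time. *)
rewrite -/(u s) (pgf_levy_powR levyZ at0 s01) (pgf_levy_powR levyZ (ltW t0) (u01 _ s01)).
by rewrite powRrM -/(G s) Ga.
Qed.
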